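(* Let $J$ be an index set and let $\{T_j\}_{j\in J}$ be a family of (singular) integral operators on $\mathbb R^n$, $$T_jf(x)=\mathrm{p.v.}\int_{\mathbb R^n}K_j(x,y)f(y)\,dy,$$ whose kernels satisfy $|K_j(x,y)|\le\frac{C_0}{|x-y|^n}$ for $x\ne y$, with $C_0$ independent of $j\in J$. Let $T^*f(x)=\sup_{j\in J}|T_jf(x)|$. Let $p(\cdot)\in\mathcal P(\mathbb R^n)$ satisfy $p(\cdot)\in LH_0(\mathbb R^n)\cap LH_\infty(\mathbb R^n)$ and $1<p^-\le p^+<\infty$, and suppose that for every family of balls $\mathcal B$ with bounded overlap, $$\sum_{B\in\mathcal B}\|f\chi_B\|_{p(\cdot)}\|g\chi_B\|_{p'(\cdot)}\le C\|f\|_{p(\cdot)}\|g\|_{p'(\cdot)}$$ for all $f\in L^{p(\cdot)}(\mathbb R^n)$, $g\in L^{p'(\cdot)}(\mathbb R^n)$, where the constant $C$ is independent of $\mathcal B$ and depends only on $p(\cdot)$ and the bound on the overlap. If $T^*$ is of strong-type $(p(\cdot),p(\cdot))$, and if $w$ is a weight on $\mathbb R^n$ such that $w\in A_{p(\cdot),0}$ and there is a constant $C_1>0$ with $$\sup_{2^{k-2}\le|x|\le2^{k+1}}w(x)\le C_1\inf_{2^{k-2}\le|x|\le2^{k+1}}w(x)\quad\text{for all }k\in\mathbb Z,$$ then $T^*$ is of strong-type $(p(\cdot),p(\cdot))$ with respect to $w$.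
   Context: $\mathcal P(\mathbb R^n)$ is the set of bounded measurable functions $p(\cdot):\mathbb R^n\to[1,\infty)$; $p^-=\inf_{x\in\mathbb R^n}p(x)$ and $p^+=\sup_{x\in\mathbb R^n}p(x)$. The conjugate exponent is defined pointwise by $1/p(x)+1/p'(x)=1$. For $r(\cdot)\in\mathcal P(\mathbb R^n)$ and measurable $f$, $\|f\|_{r(\cdot)}=\inf\{\mu>0:\int_{\mathbb R^n}(|f(x)|/\mu)^{r(x)}\,dx\le1\}\in[0,\infty]$, and $L^{r(\cdot)}(\mathbb R^n)=\{f:\|f\|_{r(\cdot)}<\infty\}$. $p(\cdot)\in LH_0(\mathbb R^n)$ means there are $C>0$, $p_0\ge1$ with $|p(x)-p_0|\le \frac{C}{-\log|x|}$ for all $0<|x|<1/2$. $p(\cdot)\in LH_\infty(\mathbb R^n)$ means there are $C_\infty>0$, $p_\infty\ge1$ with $|p(x)-p_\infty|\le\frac{C_\infty}{\log(e+|x|)}$ for all $x\in\mathbb R^n$. A weight is a non-negative, locally integrable function $w$ on $\mathbb R^n$ with $0<w(x)<\infty$ a.e. $L^{p(\cdot)}_w(\mathbb R^n)$ is the set of measurable $f$ with $\|fw\|_{p(\cdot)}<\infty$. $w\in A_{p(\cdot),0}$ means there is a constant $C>0$ such that $\|w\chi_{B(0,b)}\|_{p(\cdot)}\|w^{-1}\chi_{B(0,b)}\|_{p'(\cdot)}\le Cb^n$ for every $b>0$, where $B(0,b)$ is the ball of radius $b$ centered at the origin. A family $\mathcal B$ of balls has bounded overlap if $\sum_{B\in\mathcal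 B}\chi_B\le M$ pointwise for some finite $M$ (the bound on the overlap). The kernels $K_j$ are measurable, and $\mathrm{p.v.}\int K_j(x,y)f(y)\,dy=\lim_{\varepsilon\to0^+}\int_{|x-y|>\varepsilon}K_j(x,y)f(y)\,dy$. $T^*$ is of strong-type $(p(\cdot),p(\cdot))$ with respect to $w$ if there is $K>0$ such that for every $f\in L^{p(\cdot)}_w(\mathbb R^n)$, for a.e. $x$ the values $T_jf(x)$ are defined for all $j\in J$, $T^*f$ is measurable, and $\|(T^*f)w\|_{p(\cdot)}\le K\|fw\|_{p(\cdot)}$. ''Of strong-type $(p(\cdot),p(\cdot))$'' without mention of a weight means with respect to $w\equiv1$. *)

(* Defs.v *)
From HB Require Import structures.
From mathcomp Require Import all_boot all_order all_algebra.
From mathcomp Require Import all_classical all_reals all_analysis.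
From mathcomp Require Import measurable_realfun.

Set Implicit Arguments.
Unset Strict Implicit.
Unset Printing Implicit Defensive.

Import Order.TTheory GRing.Theory Num.Theory.
Import numFieldNormedType.Exports.

Local Open Scope classical_set_scope.
Local Open Scope ring_scope.

Section LebesgueCons.
Context {R : realType} {n : nat}.
Let T := measurableTypeR R.
Variable mu : {sigma_finite_measure set (n.-tuple T) -> \bar R}.

Definition tuple_cons (z : T * n.-tuple T) : n.+1.-tuple T :=
  [the n.+1.-tuple T of z.1 :: z.2].

Lemma measurable_tuple_cons : measurable_fun [set: T * n.-tuple T] tuple_cons.
Proof.
apply: measurable_cons; [exact: measurable_fst|exact: measurable_snd].
Qed.

Definition lebesgue_cons : set (n.+1.-tuple T) -> \bar R :=
  pushforward (@lebesgue_measure R \x mu)%E tuple_cons.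

Let lebesgue_cons0 : lebesgue_cons set0 = 0%E.
Proof. by rewrite /lebesgue_cons /pushforward preimage_set0 measure0. Qed.

Let lebesgue_cons_ge0 A : (0 <= lebesgue_cons A)%E.
Proof. by rewrite /lebesgue_cons /pushforward; exact: measure_ge0. Qed.

Let lebesgue_cons_sigma_additive : semi_sigma_additive lebesgue_cons.
Proof.
move=> F mF tF mUF; rewrite /lebesgue_cons /pushforward preimage_bigcup.
have mpre A : measurable A -> measurable (tuple_cons @^-1` A).
  by move=> mA; rewrite -[X in measurable X]setTI; exact: measurable_tuple_cons.
apply: measure_semi_sigma_additive.
- by move=> k; exact: mpre.
- apply/trivIsetP => /= i j _ _ ij; rewrite -preimage_setI.
  by move/trivIsetP : tF => /(_ _ _ _ _ ij) ->//; rewrite preimage_set0.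
- by rewrite -preimage_bigcup; exact: mpre.
Qed.

HB.instance Definition _ := isMeasure.Build _ _ _ lebesgue_cons
  lebesgue_cons0 lebesgue_cons_ge0 lebesgue_cons_sigma_additive.

Let lebesgue_cons_sigma_finite : sigma_finite setT lebesgue_cons.
Proof.
have /sigma_finiteP[F [TF ndF Foo]] := sigma_finiteT (@lebesgue_measure R).
have /sigma_finiteP[G [TG ndG Goo]] := sigma_finiteT mu.
pose g (x : n.+1.-tuple T) : T * n.-tuple T := (thead x, [tuple of behead x]).
have mg : measurable_fun setT g.
  apply/measurable_fun_pairP; split => /=.
    exact: (@measurable_tnth _ T n.+1 ord0).
  exact: measurable_behead.
have gK z : g (tuple_cons z) = z.
  by case: z => a t; rewrite /g /tuple_cons /=; congr pair; exact/val_inj.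
exists (fun k => g @^-1` (F k `*` G k)).
  rewrite -preimage_bigcup [X in _ @^-1` X](_ : _ = setT) ?preimage_setT//.
  rewrite -setXTT TF TG; apply/seteqP; split=> -[x y].
    by move=> [k _ [/= Fx Gy]]; split; exists k.
  move=> [/= [k _ Fkx] [l _ Gly]]; exists (maxn k l) => //; split.
  - by move: x Fkx; exact/subsetPset/ndF/leq_maxl.
  - by move: y Gly; exact/subsetPset/ndG/leq_maxr.
move=> k; have [mF Fkoo] := Foo k; have [mG Gkoo] := Goo k; split.
  by rewrite -[X in measurable X]setTI; apply: mg => //; exact: measurableX.
rewrite /lebesgue_cons /pushforward.
rewrite -comp_preimage (_ : g \o tuple_cons = id) ?preimage_id; last first.
  exact/funext.
by rewrite product_measure1E// lte_mul_pinfty// ge0_fin_numE.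
Qed.

HB.instance Definition _ := Measure_isSigmaFinite.Build _ _ _ lebesgue_cons
  lebesgue_cons_sigma_finite.

End LebesgueCons.

(* n-fold product of the one-dimensional Lebesgue measure, on Borel sets. *)
Fixpoint lebesgue_borel (R : realType) (n : nat) :
    {sigma_finite_measure set (n.-tuple (measurableTypeR R)) -> \bar R} :=
  match n with
  | 0 => @dirac _ (0.-tuple (measurableTypeR R)) [tuple] R
  | m.+1 => lebesgue_cons (lebesgue_borel R m)
  end.

(* R^n with the sigma-algebra of all Lebesgue measurable sets, that is, the
   Caratheodory completion of the Borel sigma-algebra; [measurable_fun] on [Rn]
   is therefore Lebesgue (not Borel) measurability, and functions that are only
   determined almost everywhere cause no measurability problem. *)
Definition Rn (R : realType) (n : nat) : Type :=
  caratheodory_type ((lebesgue_borel R n)^*)%mu.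

Definition leb (R : realType) (n : nat) : {measure set (Rn R n) -> \bar R} :=
  @completed_measure_extension _ _ _ (lebesgue_borel R n).

Section Geometry.
Context {R : realType} {n : nat}.

Definition rn_coord (x : Rn R n) (i : 'I_n) : R := tnth (x : n.-tuple R) i.

Definition rn_origin : Rn R n := [tuple (0 : R) | i < n].

Definition eucl_dist (x y : Rn R n) : R :=
  Num.sqrt (\sum_(i < n) (rn_coord x i - rn_coord y i) ^+ 2).

Definition eucl_norm (x : Rn R n) : R := eucl_dist x rn_origin.

Definition eucl_ball (c : Rn R n) (r : R) : set (Rn R n) :=
  [set x | eucl_dist c x < r].

Definition is_eucl_ball (B : set (Rn R n)) : Prop :=
  exists c r, 0 < r /\ B = eucl_ball c r.

Definition overlap_le (M : R) (F : set (set (Rn R n))) : Prop :=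
  forall x, (\esum_(B in F) (\1_B x)%:E <= M%:E)%E.

Definition dyadic_annulus (k : int) : set (Rn R n) :=
  [set x | 2 ^ (k - 2) <= eucl_norm x <= 2 ^ (k + 1)].

End Geometry.

Section VariableLebesgue.
Context {R : realType} {n : nat}.
Local Notation T := (Rn R n).
Implicit Types (p r : T -> R) (f : T -> R) (g w : T -> \bar R).

(* the class P(R^n) *)
Definition variable_exponent p : Prop :=
  [/\ measurable_fun setT p, (forall x, 1 <= p x)
    & exists M, forall x, p x <= M].

Definition exp_inf p : \bar R := ereal_inf [set (p x)%:E | x in setT].
Definition exp_sup p : \bar R := ereal_sup [set (p x)%:E | x in setT].

(* The value is the finite conjugate wherever 1 < p x; where p x = 1 it is the
   irrelevant default 0 instead of +oo. *)
Definition conj_exp p : T -> R := fun x => fine (hoelder_conjugate (p x)%:E).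

Definition LH0 p : Prop :=
  exists C p0 : R, [/\ 0 < C, 1 <= p0
    & forall x, 0 < eucl_norm x < 2^-1 -> `|p x - p0| <= C / - ln (eucl_norm x)].

Definition LHoo p : Prop :=
  exists C poo : R, [/\ 0 < C, 1 <= poo
    & forall x, `|p x - poo| <= C / ln (expR 1 + eucl_norm x)].

Local Open Scope ereal_scope.

(* Luxemburg norm; the infimum of the empty set is +oo. *)
Definition varnorm r g : \bar R :=
  ereal_inf [set mu%:E | mu in [set mu : R | (0 < mu)%R /\
    \int[leb R n]_x ((`|g x| / mu%:E) `^ (r x)) <= 1]].

(* multiplication by the indicator; 0 * +oo = 0 in \bar R *)
Definition cutoff g (B : set T) : T -> \bar R := fun x => g x * (\1_B x)%:E.

Definition varL r w f : Prop :=
  measurable_fun setT f /\ varnorm r (fun x => (f x)%:E * w x) < +oo.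

Definition is_weight w : Prop :=
  [/\ measurable_fun setT w, (forall x, 0 <= w x),
      (forall c b, (leb R n).-integrable (eucl_ball c b) w)
    & {ae leb R n, forall x, 0 < w x < +oo}].

Definition Ap0 p w : Prop :=
  exists C : R, (0 < C)%R /\ forall b : R, (0 < b)%R ->
    varnorm p (cutoff w (eucl_ball rn_origin b)) *
    varnorm (conj_exp p) (cutoff (fun x => (w x)^-1) (eucl_ball rn_origin b))
      <= (C * b ^+ n)%:E.

(* The summation condition over families of balls; C may depend on p and on the
   overlap bound M only. *)
Definition ball_summable p : Prop :=
  forall M : R, exists C : R, (0 < C)%R /\
    forall F : set (set T), (forall B, F B -> is_eucl_ball B) -> overlap_le M F ->
    forall f h, varL p (cst 1) f -> varL (conj_exp p) (cst 1) h ->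
      \esum_(B in F) (varnorm p (cutoff (EFin \o f) B) *
                      varnorm (conj_exp p) (cutoff (EFin \o h) B))
      <= C%:E * varnorm p (EFin \o f) * varnorm (conj_exp p) (EFin \o h).

End VariableLebesgue.

Section MaximalOperator.
Context {R : realType} {n : nat} {J : Type}.
Local Notation T := (Rn R n).
Implicit Types (k : T -> T -> R) (K : J -> T -> T -> R) (f : T -> R).

(* Joint Lebesgue measurability on R^n x R^n, identified with R^(n + n). *)
Definition kernel_measurable k : Prop :=
  measurable_fun setT (fun z : Rn R (n + n) =>
    k [tuple rn_coord z (lshift n i) | i < n] [tuple rn_coord z (rshift n i) | i < n]).

Definition truncated_integral k f (x : T) (e : R) : R :=
  \int[leb R n]_(y in [set y | e < eucl_dist x y]) (k x y * f y).

(* [integrable] includes the measurability of the integrand. *)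
Definition pv_defined k f (x : T) : Prop :=
  (forall e, 0 < e -> (leb R n).-integrable [set y | e < eucl_dist x y]
     (fun y => (k x y * f y)%:E)) /\
  cvg (truncated_integral k f x e @[e --> 0^'+]).

Definition pv k f (x : T) : R := lim (truncated_integral k f x e @[e --> 0^'+]).

Local Open Scope ereal_scope.

(* The supremum is taken in [0, +oo]; adjoining 0 matters only if J is empty. *)
Definition Tstar K f (x : T) : \bar R :=
  ereal_sup ([set 0] `|` [set `|pv (K j) f x|%:E | j in setT]).

Definition strong_type (p : T -> R) (w : T -> \bar R) K : Prop :=
  exists A : R, (0 < A)%R /\ forall f, varL p w f ->
    [/\ {ae leb R n, forall x, forall j, pv_defined (K j) f x},
        measurable_fun setT (Tstar K f)
      & varnorm p (fun x => Tstar K f x * w x) <=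
        A%:E * varnorm p (fun x => (f x)%:E * w x)].

End MaximalOperator.

(* Main.v *)
Require Import Defs.
From HB Require Import structures.
From mathcomp Require Import all_boot all_order all_algebra.
From mathcomp Require Import all_classical all_reals all_analysis.
From mathcomp Require Import measurable_realfun.
From mathcomp Require Import ring lra zify.

Set Implicit Arguments.
Unset Strict Implicit.
Unset Printing Implicit Defensive.

Import Order.TTheory GRing.Theory Num.Theory.
Import numFieldNormedType.Exports.

Local Open Scope classical_set_scope.
Local Open Scope ring_scope.

(* Split R^n into the dyadic shells I_k = {2^k <= |x| < 2^(k+1)}, enlarged to
   D_k = {2^(k-1) <= |x| < 2^(k+2)}. For x in I_k the kernel bound gives
   T^*f(x) <= T^*(f 1_{D_k})(x) + C int |f(y)| max(|x|,|y|)^(-n) dy. The weight is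
   comparable to a constant on D_k, so the first term is handled by the unweighted
   bound. For the second one, A_{p,0} together with Hoelder's inequality on a shell
   shows that ||w 1_{B(0,2^m)}||_p and ||w^(-1) 1_{B(0,2^m)}||_{p'} are comparable to
   the norms over the outermost shell of the ball; hence they decay geometrically as
   m decreases, and
     ||w 1_{I_k}||_p ||w^(-1) 1_{I_j}||_{p'} <= C eta^(2|k-j|) 2^(n max(j,k)), eta < 1.
   Thus ||T^*f w 1_{I_k}||_p <= C sum_j eta^|k-j| ||f w 1_{I_j}||_p. By the log-Hoelder
   conditions p may be replaced on I_k, at the price of a bounded factor, by its limit
   at 0 (k < 0) or at infinity (k >= 0); since eta^|k-j| is
   summable in each variable, it is bounded on the corresponding l^p, which recombines
   the shells. *)

(** * Lebesgue measure of dyadic shells *)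

(** The strong-type hypothesis speaks of the unweighted space, to which an f in the weighted space
    need not belong. Its cut-offs to finitely many shells do belong to it, because w is bounded
    below there. The existence of the principal values, the measurability of [Tstar K f], and that
    of y -> K_j(x,y) f(y) away from a fixed x are all recovered from these cut-offs, the far kernel
    controlling the tails.

    Norms are handled through admissible numbers: [lux r B g s] replaces ||g 1_B|| <= s, so the
    infimum need not be attained, and factors 2 stand in for the sharp triangle and Hoelder
    inequalities.

    The reference exponent jumps between k < 0 and k >= 0, so no single discrete l^p space is at
    hand. For j and k on the same side of 0 the exponents agree and exchanging two sums suffices; on
    opposite sides eta^|k-j| = eta^|k| eta^|j|, which is summable over all pairs by itself. The
    square in eta^(2|k-j|) is spent once on comparing the shell norms of f w with a quantity
    attached to the target shell, and once on the sum over j. *)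

Section RnMeasure.
Context {R : realType}.

Lemma borel_measurable_Rn n (A : set (Rn R n)) :
  measurable (A : set (n.-tuple (measurableTypeR R))) -> measurable A.
Proof.
move=> mA; apply: sub_caratheodory.
exact: sub_sigma_algebra.
Qed.

Lemma leb_borel n (A : set (Rn R n)) :
  measurable (A : set (n.-tuple (measurableTypeR R))) ->
  leb R n A = lebesgue_borel R n A.
Proof. by move=> mA; exact: measurable_mu_extE. Qed.

Lemma leb_complete n : measure_is_complete (leb R n).
Proof. exact: measure_is_complete_caratheodory. Qed.

Lemma measurable_rn_coord n (i : 'I_n) :
  measurable_fun [set: Rn R n] (fun x : Rn R n => rn_coord x i).
Proof.
move=> _ Y mY; rewrite setTI; apply: borel_measurable_Rn.
by rewrite -[X in measurable X]setTI; exact: (@measurable_tnth _ (measurableTypeR R)).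
Qed.

Lemma measurable_eucl_dist n (x : Rn R n) :
  measurable_fun [set: Rn R n] (eucl_dist x).
Proof.
have msqrt : measurable_fun [set: R] (@Num.sqrt R).
  by apply: continuous_measurable_fun; exact: sqrt_continuous.
apply: (measurableT_comp msqrt).
apply: measurable_sum => i; apply: measurable_funX.
apply: measurable_funB; first exact: measurable_cst.
exact: measurable_rn_coord.
Qed.

Lemma eucl_distC n (x y : Rn R n) : eucl_dist x y = eucl_dist y x.
Proof.
by rewrite /eucl_dist; congr Num.sqrt; apply: eq_bigr => i _; rewrite -sqrrN opprB.
Qed.

Lemma measurable_eucl_norm n : measurable_fun [set: Rn R n] (@eucl_norm R n).
Proof.
rewrite (_ : eucl_norm = eucl_dist rn_origin) ; first exact: measurable_eucl_dist.
by apply/funext => x; rewrite /eucl_norm eucl_distC.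
Qed.

Lemma eucl_dist_ge0 n (x y : Rn R n) : 0 <= eucl_dist x y.
Proof. exact: sqrtr_ge0. Qed.

Lemma eucl_norm_ge0 n (x : Rn R n) : 0 <= eucl_norm x.
Proof. exact: sqrtr_ge0. Qed.

Lemma eucl_normE n (x : Rn R n) : eucl_norm x = Num.sqrt (\sum_(i < n) rn_coord x i ^+ 2).
Proof.
rewrite /eucl_norm /eucl_dist; congr Num.sqrt; apply: eq_bigr => i _.
by rewrite /rn_origin /rn_coord tnth_mktuple subr0.
Qed.

Lemma sqr_eucl_norm n (x : Rn R n) : eucl_norm x ^+ 2 = \sum_(i < n) rn_coord x i ^+ 2.
Proof. by rewrite eucl_normE sqr_sqrtr// sumr_ge0// => i _; exact: sqr_ge0. Qed.

Lemma sqr_eucl_dist n (x y : Rn R n) :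
  eucl_dist x y ^+ 2 = \sum_(i < n) (rn_coord x i - rn_coord y i) ^+ 2.
Proof. by rewrite sqr_sqrtr// sumr_ge0// => i _; exact: sqr_ge0. Qed.

(* A squared substitute for the triangle inequality that avoids Cauchy-Schwarz. *)
Lemma eucl_dist_sqr_triangle n (x y : Rn R n) :
  eucl_norm x ^+ 2 <= 2 * eucl_dist x y ^+ 2 + 2 * eucl_norm y ^+ 2.
Proof.
rewrite !sqr_eucl_norm sqr_eucl_dist !mulr_sumr -big_split /=; apply: ler_sum => i _.
have := sqr_ge0 (rn_coord x i - 2 * rn_coord y i); nra.
Qed.

(** Under the hypothesis the term 2|y|^2 of the squared inequality is at most |x|^2 / 2 and is
    absorbed on the left. *)
Lemma eucl_dist_ge_half n (x y : Rn R n) :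
  2 * eucl_norm y <= eucl_norm x -> eucl_norm x <= 2 * eucl_dist x y.
Proof.
move=> yx; rewrite -(@ler_pXn2r _ 2)// ?nnegrE ?mulr_ge0 ?eucl_norm_ge0 ?eucl_dist_ge0//.
have := eucl_dist_sqr_triangle x y.
have : (2 * eucl_norm y) ^+ 2 <= eucl_norm x ^+ 2.
  by rewrite ler_pXn2r// ?nnegrE ?mulr_ge0 ?eucl_norm_ge0.
rewrite !exprMn; lra.
Qed.

Definition box n (s t : R) : set (Rn R n) := [set x | forall i, s <= rn_coord x i < t].

Lemma measurable_box_borel n (s t : R) :
  measurable (box s t : set (n.-tuple (measurableTypeR R))).
Proof.
rewrite (_ : (box s t : set (n.-tuple (measurableTypeR R))) = \bigcap_(i in [set: 'I_n])
  ((fun x : n.-tuple (measurableTypeR R) => tnth x i) @^-1` `[s, t[)).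
  apply: fin_bigcap_measurable => // i _; rewrite -[X in measurable X]setTI.
  exact: (@measurable_tnth _ (measurableTypeR R)).
apply/seteqP; split => x /= H i; first by move=> _; rewrite /= in_itv/=; exact: H.
by have := H i I; rewrite /= in_itv.
Qed.

Lemma lebesgue_borel_box n (s t : R) : s <= t ->
  lebesgue_borel R n (box s t) = ((t - s) ^+ n)%:E.
Proof.
move=> st; elim: n => [|n IH] /=.
  rewrite diracE expr0 mem_set//=; by case.
rewrite /lebesgue_cons /pushforward.
rewrite (_ : _ @^-1` _ = `[s, t[ `*` box s t); last first.
  apply/seteqP; split => -[a x] /=.
    move=> H; split; first by rewrite in_itv/=; exact: (H ord0).
    by move=> i; have := H (lift ord0 i); rewrite /rn_coord !(tnth_nth 0).
  rewrite in_itv/= => -[H1 H2] i; case: (unliftP ord0 i) => [j ->|->//].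
  by have := H2 j; rewrite /rn_coord !(tnth_nth 0).
rewrite product_measure1E//; last exact: measurable_box_borel.
rewrite IH exprS EFinM; congr (_ * _)%E.
transitivity (lebesgue_measure (`[s, t[%classic : set (measurableTypeR R))) => //.
rewrite lebesgue_measure_itv/= lte_fin.
by case: ltgtP st => // -> _; rewrite subrr.
Qed.

Lemma measurable_box n (s t : R) : measurable (@box n s t).
Proof. by apply: borel_measurable_Rn; exact: measurable_box_borel. Qed.

Lemma leb_box n (s t : R) : s <= t -> leb R n (box s t) = ((t - s) ^+ n)%:E.
Proof. by move=> st; rewrite leb_borel ?lebesgue_borel_box//; exact: measurable_box_borel. Qed.

Lemma measurable_eucl_norm_preimage n (A : set R) : measurable A ->
  measurable (@eucl_norm R n @^-1` A).
Proof. by move=> mA; rewrite -[X in measurable X]setTI; exact: measurable_eucl_norm. Qed.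

Definition shell n (i j : int) : set (Rn R n) := [set x | 2 ^ i <= eucl_norm x < 2 ^ j].

Lemma measurable_shell n i j : measurable (@shell n i j).
Proof.
have := @measurable_eucl_norm_preimage n _ (measurable_itv `[2 ^ i, (2:R) ^ j[).
by congr (measurable _); apply/seteqP; split => x /=; rewrite in_itv.
Qed.

Lemma measurable_eucl_ball n (r : R) : measurable (eucl_ball (@rn_origin R n) r).
Proof.
have -> : eucl_ball (@rn_origin R n) r = eucl_norm @^-1` `]-oo, r[%classic.
  by apply/seteqP; split => x /=; rewrite in_itv/= /eucl_ball/= eucl_distC.
exact: measurable_eucl_norm_preimage.
Qed.

(** The shell contains the cube of points with all coordinates in [2^k / sqrt n, 2^(k+1) / sqrt n),
    since a vector with n equal coordinates a / sqrt n has norm a. *)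
Lemma leb_shell_ge n (k : int) : (0 < n)%N ->
  (((2 ^ k / Num.sqrt n%:R) ^+ n)%:E <= leb R n (shell k (k + 1)))%E.
Proof.
move=> n0; set m := Num.sqrt n%:R : R.
have m0 : 0 < m by rewrite sqrtr_gt0 ltr0n.
have k0 : 0 < (2 : R) ^ k by rewrite exprz_gt0.
have e2 : (2 : R) ^ (k + 1) = 2 ^ k * 2 by rewrite expfzDr// expr1z.
have -> : (2 ^ k / m = 2 ^ (k + 1) / m - 2 ^ k / m :> R).
  by rewrite e2; field; rewrite gt_eqF.
have D : (2 : R) ^ k / m <= 2 ^ (k + 1) / m by rewrite ler_pM2r ?invr_gt0// e2; lra.
rewrite -leb_box//; apply: le_measure; rewrite ?inE;
  [exact: measurable_box|exact: measurable_shell|].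
move=> x H; rewrite /shell/= eucl_normE.
have E (a : R) : 0 <= a -> a = Num.sqrt (\sum_(i < n) (a / m) ^+ 2).
  move=> a0; rewrite sumr_const card_ord -mulr_natl expr_div_n sqr_sqrtr ?ler0n//.
  by rewrite mulrC divfK ?pnatr_eq0 -?lt0n// sqrtr_sqr ger0_norm.
apply/andP; split.
  rewrite (E (2 ^ k)) ?(ltW k0)//; apply: ler_wsqrtr; apply: ler_sum => i _.
  have /andP[H1 _] := H i; rewrite ler_pXn2r// ?nnegrE ?divr_ge0 ?ltW//.
  by apply: lt_le_trans H1; rewrite divr_gt0.
have k1 : 0 < (2 : R) ^ (k + 1) by rewrite exprz_gt0.
rewrite (E (2 ^ (k + 1))) ?(ltW k1)// ltr_sqrt; last first.
  by rewrite sumr_const card_ord pmulrn_lgt0// exprn_gt0// divr_gt0.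
apply: ltr_sum; first by apply/hasP; exists (Ordinal n0); rewrite ?mem_index_enum.
move=> i _; have /andP[H1 H2] := H i.
have H0 : 0 < rn_coord x i by apply: lt_le_trans H1; rewrite divr_gt0.
by rewrite ltr_pXn2r// ?nnegrE ?divr_ge0 ?ltW.
Qed.

Lemma eucl_norm_eq0 n (x : Rn R n) : eucl_norm x = 0 -> x = rn_origin.
Proof.
move=> x0; have := sqr_eucl_norm x; rewrite x0 expr0n/= => /esym/psumr_eq0P H.
apply: eq_from_tnth => i; rewrite tnth_mktuple; apply/eqP; rewrite -sqrf_eq0.
by rewrite H// => j _; exact: sqr_ge0.
Qed.

Lemma measurable_origin n : measurable [set @rn_origin R n].
Proof.
rewrite (_ : [set rn_origin] = eucl_norm @^-1` [set 0]).
  by apply: measurable_eucl_norm_preimage.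
apply/seteqP; split => x /=; last exact: eucl_norm_eq0.
by move=> ->; rewrite /eucl_norm /eucl_dist big1 ?sqrtr0// => i _; rewrite subrr expr0n.
Qed.

Lemma leb_origin n : (0 < n)%N -> leb R n [set rn_origin] = 0%E.
Proof.
move=> n0; apply/eqP; rewrite eq_le measure_ge0 andbT; apply/lee_addgt0Pr => e e0.
(* Capping the side length at 1 makes its n-th power at most the side length, hence at most e. *)
have e1 : 0 < Num.min e 1 by rewrite lt_min e0/=.
rewrite add0e (le_trans (y := leb R n (box 0 (Num.min e 1))))//.
  apply: le_measure; rewrite ?inE; [exact: measurable_origin|exact: measurable_box|].
  by move=> _ -> i; rewrite /rn_coord tnth_mktuple lexx.
rewrite leb_box ?(ltW e1)// subr0 lee_fin; case: n n0 => // n _.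
rewrite exprS (le_trans (y := Num.min e 1)) ?ge_min ?lexx//.
rewrite -[leRHS]mulr1 ler_pM2l//; apply: exprn_ile1; first exact: ltW.
by rewrite ge_min lexx orbT.
Qed.

Lemma exists_dyadic (t : R) : 0 < t -> exists k : int, 2 ^ k <= t < 2 ^ (k + 1).
Proof.
move=> t0; have l2 : 0 < ln 2 :> R by rewrite ln_gt0// ltr1n.
have E (k : int) : 2 ^ k = expR (k%:~R * ln 2) :> R.
  by rewrite -powR_intmul// /powR pnatr_eq0.
exists (Num.floor (ln t / ln 2)); rewrite !E -{2 3}(@lnK _ t)// ler_expR ltr_expR.
rewrite -ler_pdivlMr// -ltr_pdivrMr//.
by rewrite floor_le floorD1_gt.
Qed.

Lemma shell_cover n : ~` [set @rn_origin R n] = \bigcup_(k : int) shell k (k + 1).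
Proof.
apply/seteqP; split => x /=.
  move=> x0; have : 0 < eucl_norm x.
    by rewrite lt_neqAle eucl_norm_ge0 andbT; apply/eqP => /esym/eucl_norm_eq0.
  by move=> /exists_dyadic[k xk]; exists k.
move=> [k _ /= /andP[H _]] E; move: H.
rewrite E leNgt /eucl_norm /eucl_dist big1 ?sqrtr0 ?exprz_gt0// => i _.
by rewrite subrr expr0n.
Qed.

Lemma ler_2exprz (i j : int) : ((2 : R) ^ i <= 2 ^ j) = (i <= j).
Proof. by rewrite ler_eXz2l// ltr1n. Qed.

Lemma trivIset_shell n : trivIset setT (fun k : int => @shell n k (k + 1)).
Proof.
move=> i j _ _ [x [/= /andP[i1 i2] /andP[j1 j2]]].
have := le_lt_trans i1 j2; have := le_lt_trans j1 i2.
by rewrite !ltr_eXz2l ?ltr1n// !ltzD1 => ji ij; apply/eqP; rewrite eq_le ij ji.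
Qed.

End RnMeasure.

(** * Modulars with variable exponent *)

Section PowerMeasurability.
Context d (T : measurableType d) (R : realType).

Lemma measurable_fun_powR2 (f r : T -> R) :
  measurable_fun setT f -> measurable_fun setT r ->
  measurable_fun setT (fun x => f x `^ r x).
Proof.
move=> mf mr; rewrite /powR; apply: measurable_fun_ifT => //.
- exact: measurable_fun_eqr.
- apply: (@measurableT_comp _ _ _ _ _ _ (fun b : bool => b%:R : R)) => //.
  exact: measurable_fun_eqr.
- apply: measurableT_comp => //; apply: measurable_funM => //.
  exact: measurableT_comp.
Qed.

Lemma measurable_fun_poweR2 (f : T -> \bar R) (r : T -> R) :
  (forall x, 0 <= f x)%E -> (forall x, 0 < r x) ->
  measurable_fun setT f -> measurable_fun setT r ->
  measurable_fun setT (fun x => (f x `^ r x)%E).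
Proof.
move=> f0 r0 mf mr.
rewrite (_ : (fun x => _) = fun x => if f x == +oo%E then +oo%E
    else ((fine (f x)) `^ r x)%:E).
  apply: measurable_fun_ifT => //; first exact: measurable_fun_eqe.
  apply/measurable_EFinP; apply: measurable_fun_powR2 => //.
  exact: measurableT_comp.
apply/funext => x; have := f0 x; case: (f x) => [a| |]//= _.
by rewrite gt_eqF.
Qed.

End PowerMeasurability.

Section Modular.
Local Open Scope ereal_scope.
Context d (T : measurableType d) (R : realType) (mu : {measure set T -> \bar R}).
Implicit Types (g h : T -> \bar R) (B : set T) (s t : R).

Definition modular (r : T -> R) B g s : \bar R :=
  \int[mu]_(x in B) ((`|g x| / s%:E) `^ r x).

(** Admissibility of s in the infimum that defines the Luxemburg norm of g 1_B. Estimates transport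
    admissible numbers, and norms enter only at the two ends of the argument. *)
Definition lux (r : T -> R) B g s : Prop := (0 < s)%R /\ modular r B g s <= 1.

Lemma dive_pos (a : \bar R) s : (0 < s)%R -> a / s%:E = a * (s^-1)%:E.
Proof. by move=> s0; rewrite inver gt_eqF. Qed.

Lemma ratio_ge0 g s x : (0 < s)%R -> 0 <= `|g x| / s%:E.
Proof. by move=> s0; rewrite mule_ge0// inve_ge0 lee_fin ltW. Qed.

Lemma ge0_ler_poweR (a b : \bar R) q : (0 <= q)%R -> 0 <= a -> a <= b -> a `^ q <= b `^ q.
Proof.
by move=> q0 a0 ab; rewrite gt0_ler_poweR// in_itv/= leey ?andbT// (le_trans a0).
Qed.

Lemma modular_ge0 r B g s : 0 <= modular r B g s.
Proof. by apply: integral_ge0 => x _; exact: poweR_ge0. Qed.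

Section FixedExponent.
Variable r : T -> R.
Hypothesis mr : measurable_fun setT r.
Hypothesis r1 : forall x, (1 <= r x)%R.

Let r0 x : (0 < r x)%R. Proof. exact: lt_le_trans (r1 x). Qed.

Lemma measurable_modular g s B : measurable_fun setT g -> (0 < s)%R ->
  measurable_fun B (fun x => (`|g x| / s%:E) `^ r x).
Proof.
move=> mg s0; apply: (@measurable_funS _ _ _ _ setT) => //.
apply: measurable_fun_poweR2 => //; first by move=> x; exact: ratio_ge0.
under eq_fun do rewrite dive_pos//.
by apply: emeasurable_funM => //; exact: measurableT_comp.
Qed.

Lemma modular_ae_le B g h s t : measurable B ->
  measurable_fun setT g -> measurable_fun setT h -> (0 < s)%R -> (0 < t)%R ->
  {ae mu, forall x, B x -> `|g x| / s%:E <= `|h x| / t%:E} ->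
  modular r B g s <= modular r B h t.
Proof.
move=> mB mg mh s0 t0 gh; apply: ae_ge0_le_integral => //.
- by move=> x _; exact: poweR_ge0.
- exact: measurable_modular.
- by move=> x _; exact: poweR_ge0.
- exact: measurable_modular.
- apply: filterS gh => x + Bx => /(_ Bx) gh.
  by apply: ge0_ler_poweR => //; [exact/ltW/r0|exact: ratio_ge0].
Qed.

Lemma lux_ae_le B g h s t : measurable B ->
  measurable_fun setT g -> measurable_fun setT h -> (s <= t)%R ->
  {ae mu, forall x, B x -> `|g x| <= `|h x|} ->
  lux r B h s -> lux r B g t.
Proof.
move=> mB mg mh st gh [s0 H]; have t0 := lt_le_trans s0 st.
split=> //; apply: le_trans H; apply: modular_ae_le => //.
apply: filterS gh => x + Bx => /(_ Bx) gh; rewrite !dive_pos//.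
apply: lee_pmul => //; first by rewrite lee_fin invr_ge0 ltW.
by rewrite lee_fin lef_pV2.
Qed.

Lemma lux_le B g s t : measurable B -> measurable_fun setT g -> (s <= t)%R ->
  lux r B g s -> lux r B g t.
Proof. by move=> mB mg st; apply: lux_ae_le => //; apply: aeW => x _. Qed.

Lemma modular_subset A B g s : measurable A -> measurable B -> A `<=` B ->
  measurable_fun setT g -> (0 < s)%R -> modular r A g s <= modular r B g s.
Proof.
move=> mA mB AB mg s0; apply: ge0_subset_integral => //.
- exact: measurable_modular.
- by move=> x _; exact: poweR_ge0.
Qed.

Lemma lux_subset A B g s : measurable A -> measurable B -> A `<=` B ->
  measurable_fun setT g -> lux r B g s -> lux r A g s.
Proof.
move=> mA mB AB mg [s0 H]; split=> //; apply: le_trans H.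
exact: modular_subset.
Qed.

Lemma modular_setU A B g s : measurable A -> measurable B -> [disjoint A & B] ->
  measurable_fun setT g -> (0 < s)%R ->
  modular r (A `|` B) g s = modular r A g s + modular r B g s.
Proof.
move=> mA mB AB mg s0; apply: ge0_integral_setU => //.
- exact: measurable_modular.
- by move=> x _; exact: poweR_ge0.
Qed.

(** Dividing by a further factor c multiplies the integrand by c^(-r(x)). As r varies, only a bound
    q of this factor on B can leave the integral. The constant c may lie on either side of 1; with c
    depending on the shell, this is also how a variable exponent is traded for a constant one. *)
Lemma modular_rescale B g s c q : measurable B -> measurable_fun setT g ->
  (0 < s)%R -> (0 < c)%R -> (forall x, B x -> (c^-1 `^ r x <= q)%R) -> (0 <= q)%R ->
  modular r B g (c * s) <= q%:E * modular r B g s.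
Proof.
move=> mB mg s0 c0 cq q0; have cs0 : (0 < c * s)%R by exact: mulr_gt0.
rewrite /modular -ge0_integralZl_EFin//; last 2 first.
- by move=> x _; exact: poweR_ge0.
- exact: measurable_modular.
apply: ge0_le_integral => //.
- by move=> x _; exact: poweR_ge0.
- exact: measurable_modular.
- by apply: emeasurable_funM => //; exact: measurable_modular.
- move=> x Bx; rewrite !dive_pos// invfM EFinM muleCA.
  rewrite [leLHS]poweRM ?mule_ge0 ?lee_fin ?invr_ge0 ?(ltW s0) ?(ltW c0)//.
  by rewrite lee_wpmul2r ?poweR_ge0// poweR_EFin lee_fin cq.
Qed.

Lemma modular_shrink B g s c : measurable B -> measurable_fun setT g ->
  (0 < s)%R -> (1 <= c)%R ->
  modular r B g (c * s) <= (c^-1)%:E * modular r B g s.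
Proof.
move=> mB mg s0 c1; have c0 : (0 < c)%R by exact: lt_le_trans c1.
apply: modular_rescale => //; last by rewrite invr_ge0 ltW.
by move=> x _; rewrite ge1r_powR// invr_gt0 c0 invf_le1.
Qed.

Lemma modular_grow B g s c q : measurable B -> measurable_fun setT g ->
  (0 < s)%R -> (1 <= c)%R -> (forall x, B x -> r x <= q)%R ->
  modular r B g s <= (c `^ q)%:E * modular r B g (c * s).
Proof.
move=> mB mg s0 c1 rq; have c0 : (0 < c)%R by exact: lt_le_trans c1.
rewrite -{1}(mulKf (lt0r_neq0 c0) s).
apply: modular_rescale => //; rewrite ?mulr_gt0 ?invr_gt0 ?powR_ge0//.
by move=> x Bx; rewrite invrK ler_powR// rq.
Qed.

(** Turns a bound on a sum of modulars back into an admissible number; the loss is only linear in c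
    because r >= 1. *)
Lemma lux_modular_bound B g s c : measurable B -> measurable_fun setT g ->
  (0 < s)%R -> (1 <= c)%R -> modular r B g s <= c%:E -> lux r B g (c * s).
Proof.
move=> mB mg s0 c1 H; have c0 : (0 < c)%R by exact: lt_le_trans c1.
split; first exact: mulr_gt0.
apply: (le_trans (modular_shrink mB mg s0 c1)).
apply: (le_trans (y := (c^-1)%:E * c%:E)).
  by rewrite lee_wpmul2l// lee_fin invr_ge0 ltW.
by rewrite -EFinM mulVf ?gt_eqF.
Qed.

Lemma modularZ B g s c : (0 < s)%R -> (0 < c)%R ->
  modular r B (fun x => c%:E * g x) (c * s) = modular r B g s.
Proof.
move=> s0 c0; apply: eq_integral => x _; rewrite !dive_pos ?mulr_gt0//.
rewrite abseM /= gtr0_norm// invfM EFinM muleACA -EFinM mulfV ?gt_eqF//.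
by rewrite mul1e.
Qed.

Lemma lux_add B g h k s t : measurable B ->
  measurable_fun setT g -> measurable_fun setT h -> measurable_fun setT k ->
  {ae mu, forall x, B x -> `|k x| <= `|g x| + `|h x|} ->
  lux r B g s -> lux r B h t -> lux r B k (2 * (s + t)).
Proof.
move=> mB mg mh mk kgh [s0 Hg] [t0 Ht]; have st0 := addr_gt0 s0 t0.
split; first exact: mulr_gt0.
have st2 : (0 < 2 * (s + t))%R by exact: mulr_gt0.
pose F x := (2^-1)%:E * ((`|g x| / s%:E) `^ r x + (`|h x| / t%:E) `^ r x).
apply: (le_trans (y := \int[mu]_(x in B) F x)); last first.
  rewrite ge0_integralZl_EFin//; last 2 first.
  - by move=> x _; rewrite adde_ge0// poweR_ge0.
  - by apply: emeasurable_funD; exact: measurable_modular.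
  rewrite ge0_integralD//; last 4 first.
  - by move=> x _; rewrite poweR_ge0.
  - exact: measurable_modular.
  - by move=> x _; rewrite poweR_ge0.
  - exact: measurable_modular.
  apply: (le_trans (y := (2^-1)%:E * (1 + 1))); first by rewrite lee_wpmul2l// leeD.
  by rewrite -EFinD -EFinM mulVf.
apply: ae_ge0_le_integral => //.
- by move=> x _; exact: poweR_ge0.
- exact: measurable_modular.
- by move=> x _; rewrite mule_ge0// adde_ge0// poweR_ge0.
- by apply: emeasurable_funM => //; apply: emeasurable_funD; exact: measurable_modular.
apply: filterS kgh => x + Bx => /(_ Bx) kgh.
pose a := maxe (`|g x| / s%:E) (`|h x| / t%:E).
have a0 : 0 <= a by rewrite le_max ratio_ge0.
have ga : `|g x| <= a * s%:E.
  rewrite -[leLHS]mule1 -(_ : (s^-1)%:E * s%:E = 1); last by rewrite -EFinM mulVf ?gt_eqF.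
  by rewrite muleA lee_wpmul2r ?lee_fin ?(ltW s0)// -dive_pos// le_max lexx.
have ha : `|h x| <= a * t%:E.
  rewrite -[leLHS]mule1 -(_ : (t^-1)%:E * t%:E = 1); last by rewrite -EFinM mulVf ?gt_eqF.
  by rewrite muleA lee_wpmul2r ?lee_fin ?(ltW t0)// -dive_pos// le_max lexx orbT.
have ka : `|k x| / (2 * (s + t))%:E <= (2^-1)%:E * a.
  rewrite dive_pos//.
  apply: (le_trans (y := a * (s + t)%:E * ((2 * (s + t))^-1)%:E)).
    rewrite lee_wpmul2r// ?lee_fin ?invr_ge0 ?(ltW st2)//.
    by apply: (le_trans kgh); rewrite EFinD ge0_muleDr ?lee_fin ?(ltW s0) ?(ltW t0)// leeD.
  by rewrite -muleA -EFinM invfM mulrCA mulfV ?gt_eqF// mulr1 muleC.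
apply: (@le_trans _ _ (((2^-1)%:E * a) `^ r x)).
  by apply: ge0_ler_poweR => //; [exact/ltW/r0|exact: ratio_ge0].
rewrite poweRM//; apply: lee_pmul; rewrite ?poweR_ge0//.
  rewrite poweR_EFin lee_fin ge1r_powR//; apply/andP; split; first by lra.
  by lra.
have [->|->] : a = `|g x| / s%:E \/ a = `|h x| / t%:E.
  by rewrite /a /Order.max; case: ifP; [right|left].
- by rewrite leeDl// poweR_ge0.
- by rewrite leeDr// poweR_ge0.
Qed.

End FixedExponent.

Lemma young_ereal (a b : \bar R) (p q : R) : 0 <= a -> 0 <= b ->
  (1 < p)%R -> (1 < q)%R -> (p^-1 + q^-1 = 1)%R ->
  a * b <= a `^ p + b `^ q.
Proof.
move=> a0 b0 p1 q1 pq.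
have p0 : (0 < p)%R by lra. have q0 : (0 < q)%R by lra.
case: a a0 => [a a0| _|//]; last first.
  by rewrite poweRyr ?gt_eqF// addye ?leey// gt_eqF// (lt_le_trans ltNy0)// poweR_ge0.
case: b b0 => [b b0| _|//]; last by rewrite (@poweRyr _ q) ?gt_eqF// addey ?leey.
rewrite -EFinM !poweR_EFin -EFinD lee_fin.
apply: (le_trans (conjugate_powR a0 b0 p0 q0 pq)).
by apply: lerD; rewrite ler_pdivrMr// ler_peMr ?powR_ge0// ltW.
Qed.

(** Pointwise Young inequality for |g|/s and |h|/t, with the factors 1/p and 1/q bounded by 1; each
    of the two modulars then contributes at most 1, hence the 2. *)
Lemma modular_hoelder (p q : T -> R) B g h s t : measurable B ->
  measurable_fun setT p -> measurable_fun setT q ->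
  (forall x, 1 < p x)%R -> (forall x, 1 < q x)%R ->
  (forall x, (p x)^-1 + (q x)^-1 = 1)%R ->
  measurable_fun setT g -> measurable_fun setT h ->
  lux p B g s -> lux q B h t ->
  \int[mu]_(x in B) (`|g x| * `|h x|) <= (2 * s * t)%:E.
Proof.
move=> mB mp mq p1 q1 pq mg mh [s0 Hg] [t0 Hh].
have mP := measurable_modular mp (fun x => ltW (p1 x)) (B := B) mg s0.
have mQ := measurable_modular mq (fun x => ltW (q1 x)) (B := B) mh t0.
have ag : measurable_fun B (fun x => `|g x|).
  by apply: (@measurable_funS _ _ _ _ setT) => //; exact: measurableT_comp.
have ah : measurable_fun B (fun x => `|h x|).
  by apply: (@measurable_funS _ _ _ _ setT) => //; exact: measurableT_comp.
rewrite (eq_integral (fun x => (s * t)%:E * ((`|g x| / s%:E) * (`|h x| / t%:E)))); last first.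
  move=> x _; rewrite !dive_pos// muleACA -EFinM -invfM muleCA -EFinM.
  by rewrite mulfV ?mule1// gt_eqF// mulr_gt0.
rewrite ge0_integralZl_EFin//; last 3 first.
- by move=> x _; apply: mule_ge0; exact: ratio_ge0.
- under eq_fun do rewrite !dive_pos//.
  by apply: emeasurable_funM => //; apply: emeasurable_funM.
- by rewrite mulr_ge0// ltW.
rewrite -mulrA (mulrC 2%R) [in leRHS]EFinM.
apply: (@lee_wpmul2l _ (s * t)%:E); first by rewrite lee_fin mulr_ge0 ?(ltW s0) ?(ltW t0).
apply: (le_trans (y := \int[mu]_(x in B) ((`|g x| / s%:E) `^ p x + (`|h x| / t%:E) `^ q x))).
  apply: ge0_le_integral => //.
  - by move=> x _; apply: mule_ge0; exact: ratio_ge0.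
  - under eq_fun do rewrite !dive_pos//.
    by apply: emeasurable_funM => //; apply: emeasurable_funM.
  - by apply: emeasurable_funD.
  - by move=> x _; apply: young_ereal => //; exact: ratio_ge0.
rewrite ge0_integralD//; last 2 first.
- by move=> x _; rewrite poweR_ge0.
- by move=> x _; rewrite poweR_ge0.
by apply: (le_trans (y := (1 + 1)%E)); [exact: leeD|rewrite -EFinD].
Qed.

End Modular.

(** * Sums over the integers *)

Section CountableSums.
Local Open Scope ereal_scope.
Context {R : realType}.

Lemma nneseries_unpickle (I : countType) (a : I -> \bar R) : (forall i, 0 <= a i) ->
  \sum_(k <oo) (if pickle_inv k is Some i then a i else 0) = \esum_(i in [set: I]) a i.
Proof.
move=> a0; rewrite nneseries_esumT; last by move=> k; case: pickle_inv.
pose b (k : nat) := if (pickle_inv k : option I) is Some i then a i else 0.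
rewrite -[LHS]/(\esum_(k in [set: nat]) b k).
rewrite (@esumID _ _ [set k | exists i : I, pickle i = k] _ b); last first.
  by move=> k _; rewrite /b; case: pickle_inv.
rewrite [X in _ + X]esum1 ?adde0; last first.
  move=> k [_ /= nk]; rewrite /b; case E : pickle_inv => [i|//].
  by exfalso; apply: nk; exists i; have := @pickle_invK I k; rewrite /oapp E.
rewrite setTI (reindex_esum [set: I] _ (@pickle I)).
  by apply: eq_esum => i _; rewrite /b pickleK_inv.
split.
- by move=> i _; exists i.
- by move=> i j _ _; exact: (pcan_inj pickleK).
- by move=> k [i <-]; exists i.
Qed.

Lemma ge0_integral_bigcup_countable d (T : measurableType d)
    (mu : {measure set T -> \bar R}) (I : countType) (F : I -> set T) (f : T -> \bar R) :
  (forall i, measurable (F i)) -> trivIset setT F ->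
  measurable_fun (\bigcup_i F i) f -> (forall x, 0 <= f x) ->
  \int[mu]_(x in \bigcup_i F i) f x = \esum_(i in [set: I]) \int[mu]_(x in F i) f x.
Proof.
move=> mF tF mf f0.
pose G k := if (pickle_inv k : option I) is Some i then F i else set0.
have FG : \bigcup_i F i = \bigcup_k G k.
  apply/seteqP; split => x [i _ Fx].
    by exists (pickle i) => //; rewrite /G pickleK_inv.
  by move: Fx; rewrite /G; case: pickle_inv => [j Fx|//]; exists j.
rewrite FG ge0_integral_bigcup//.
- rewrite -nneseries_unpickle; last by move=> i; exact: integral_ge0.
  apply: eq_eseriesr => k _; rewrite /G; case: pickle_inv => //.
  exact: integral_set0.
- by move=> k; rewrite /G; case: pickle_inv.
- by rewrite -FG.
- move=> k l _ _ [x]; rewrite /G /setI /=.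
  case Ek : (pickle_inv k) => [i|]; case El : (pickle_inv l) => [j|] [Fi Fj]//.
  have ij : i = j by apply: tF => //; exists x.
  have := @pickle_invK I k; have := @pickle_invK I l.
  by rewrite Ek El /oapp ij => -> ->.
Qed.

Lemma ge0_integral_conull_bigcup d (T : measurableType d)
    (mu : {measure set T -> \bar R}) (I : countType) (F : I -> set T) (f : T -> \bar R) :
  (forall i, measurable (F i)) -> trivIset setT F -> mu (~` \bigcup_i F i) = 0 ->
  measurable_fun setT f -> (forall x, 0 <= f x) ->
  \int[mu]_x f x = \esum_(i in [set: I]) \int[mu]_(x in F i) f x.
Proof.
move=> mF tF F0 mf f0.
have mU : measurable (\bigcup_i F i) by apply: countable_bigcupT_measurable => //.
have mfS A : measurable_fun A f by exact: (measurable_funS measurableT _ mf).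
rewrite -(setUv (\bigcup_i F i)) ge0_integral_setU//; last 2 first.
- exact: measurableC.
- by apply/disj_setPS; rewrite setICr.
rewrite [X in (_ + X)%E]null_set_integral//; last exact: measurableC.
by rewrite adde0 ge0_integral_bigcup_countable.
Qed.

Lemma esum_geometric_int (eta : R) : (0 < eta < 1)%R ->
  exists2 S : R, (1 <= S)%R &
    forall k : int, \esum_(j in [set: int]) (eta ^+ `|k - j|%N)%:E <= S%:E.
Proof.
move=> /andP[e0 e1].
have geo : \sum_(n <oo) (eta ^+ n)%:E = ((1 - eta)^-1)%:E.
  have H : \sum_(0 <= i < n) (eta ^+ i)%:E @[n --> \oo] --> ((1 - eta)^-1)%:E.
    under eq_fun do rewrite sumEFin.
    apply/fine_cvgP; split; first exact: nearW.
    have := @cvg_geometric_series R 1%R eta; rewrite ger0_norm ?ltW// => /(_ e1).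
    rewrite mul1r; apply: cvg_trans; apply: near_eq_cvg; apply: nearW => n /=.
    by rewrite /series/=; apply: eq_bigr => i _; rewrite mul1r.
  exact/cvg_lim.
(* The nonnegative and the negative values of k - j contribute at most one geometric series each. *)
exists (2 * (1 - eta)^-1)%R.
  by rewrite ler_pdivlMr ?mul1r; lra.
move=> k; rewrite (reindex_esum [set: int] _ (fun j => k - j)%R); last first.
  split => //; first by move=> i j _ _ /addrI /oppr_inj.
  by move=> i _; exists (k - i)%R => //; rewrite subKr.
under eq_esum do rewrite subKr.
rewrite (esumID (range Posz))//; last by move=> i _; rewrite lee_fin exprn_ge0// ltW.
rewrite mulr2n mulrDl !mul1r EFinD; apply: leeD.
  rewrite setTI (reindex_esum [set: nat] _ Posz).
    by rewrite -nneseries_esumT ?geo// => n; rewrite lee_fin exprn_ge0// ltW.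
  split; [by move=> i _; exists i|by move=> i j _ _ []|by move=> _ [i _ <-]; exists i].
rewrite setTI (reindex_esum [set: nat] _ Negz).
  rewrite -nneseries_esumT; last by move=> n; rewrite lee_fin exprn_ge0// ltW.
  rewrite -geo; apply: lee_nneseries => n _; first by rewrite lee_fin exprn_ge0// ltW.
  by rewrite lee_fin/= exprS ger_pMl ?exprn_gt0// ltW.
split; [by move=> i _ [j _]|by move=> i j _ _ []|].
by move=> [i|i] ni; [exfalso; apply: ni; exists i|exists i].
Qed.

End CountableSums.

(** * Luxemburg norms and exponents on R^n *)

Section Cutoff.
Local Open Scope ereal_scope.
Context d (T : measurableType d) (R : realType).

Lemma measurable_mul_indic (g : T -> \bar R) (B : set T) : measurable B ->
  measurable_fun setT g -> measurable_fun setT (fun x => g x * (\1_B x)%:E).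
Proof.
move=> mB mg; apply: emeasurable_funM => //.
by apply/measurable_EFinP; exact: measurable_indic.
Qed.

Lemma modular_mul_indic (mu : {measure set T -> \bar R}) (r : T -> R) (g : T -> \bar R)
    (A B : set T) (s : R) : measurable A -> measurable B -> (forall x, 1 <= r x)%R ->
  (0 < s)%R ->
  modular mu r A (fun x => g x * (\1_B x)%:E) s = modular mu r (A `&` B) g s.
Proof.
move=> mA mB r1 s0; rewrite /modular [RHS]integral_mkcondr; apply: eq_integral => x _.
rewrite patchE indicE; case: (x \in B); first by rewrite mule1.
rewrite mule0 abse0 mul0e poweR0r//.
by rewrite gt_eqF// (lt_le_trans _ (r1 x)).
Qed.

Lemma measurable_invr_fun (f : T -> R) : measurable_fun setT f ->
  measurable_fun setT (fun x => (f x)^-1)%R.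
Proof.
(* The power function is used for nonnegative arguments only, so negative values are reflected; at 0
   the inverse and the power -1 are both 0. *)
move=> mf; rewrite (_ : (fun x => _) = fun x =>
    (if (f x < 0) then - ((- f x) `^ (-1)) else (f x) `^ (-1))%R).
  apply: measurable_fun_ifT; first exact: measurable_fun_ltr.
  - apply: measurableT_comp => //.
    apply: (measurableT_comp (measurable_powR _)).
    exact: measurableT_comp.
  - exact: (measurableT_comp (measurable_powR _)).
apply/funext => x; case: ltP => H; last by rewrite powR_inv1.
by rewrite powR_inv1 ?oppr_ge0 ?(ltW H)// invrN opprK.
Qed.

Lemma measurable_conjugate (p : T -> R) : measurable_fun setT p ->
  measurable_fun setT (fun x => p x / (p x - 1))%R.
Proof.
move=> mp; apply: measurable_funM => //; apply: measurable_invr_fun.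
exact: measurable_funB.
Qed.

Lemma measurable_inve_fun (w : T -> \bar R) : measurable_fun setT w ->
  measurable_fun setT (fun x => (w x)^-1).
Proof.
move=> mw; rewrite (_ : (fun x => _) = fun x => if w x == 0 then +oo else
    if w x == +oo then 0 else if w x == -oo then -oo else ((fine (w x))^-1)%:E).
  apply: measurable_fun_ifT => //; first exact: measurable_fun_eqe.
  apply: measurable_fun_ifT => //; first exact: measurable_fun_eqe.
  apply: measurable_fun_ifT => //; first exact: measurable_fun_eqe.
  by apply/measurable_EFinP; apply: measurable_invr_fun; exact: measurableT_comp.
by apply/funext => x; case: (w x) => [a| |]//=; rewrite eqe inver.
Qed.

Lemma measurable_mulEFin (f : T -> R) (w : T -> \bar R) :
  measurable_fun setT f -> measurable_fun setT w ->
  measurable_fun setT (fun x => (f x)%:E * w x).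
Proof. by move=> mf mw; apply: emeasurable_funM => //; exact/measurable_EFinP. Qed.

End Cutoff.

Section VariableNorm.
Local Open Scope ereal_scope.
Context {R : realType} {n : nat}.
Implicit Types (r p : Rn R n -> R) (g : Rn R n -> \bar R) (B : set (Rn R n)).

(** Admissible numbers are closed upwards, so everything strictly above the infimum is admissible.
    The strict inequality is the source of the harmless factors 2 further on. *)
Lemma varnorm_lt_lux r g (s : R) : measurable_fun setT r -> (forall x, 1 <= r x)%R ->
  measurable_fun setT g -> varnorm r g < s%:E -> lux (leb R n) r setT g s.
Proof.
move=> mr r1 mg /ereal_inf_lt[_ [t [t0 Ht] <-]]; rewrite lte_fin => ts.
exact: (lux_le mr r1 _ mg (ltW ts)).
Qed.

Lemma lux_varnorm r g (s : R) : lux (leb R n) r setT g s -> varnorm r g <= s%:E.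
Proof. by move=> [s0 Hs]; apply: ereal_inf_lbound; exists s. Qed.

Lemma varnorm_ge0 r g : 0 <= varnorm r g.
Proof.
by apply: le_ereal_inf_tmp => _ [t [t0 _] <-]; rewrite lee_fin ltW.
Qed.

Lemma measurable_cutoff g B : measurable B -> measurable_fun setT g ->
  measurable_fun setT (cutoff g B).
Proof. exact: measurable_mul_indic. Qed.

Lemma cutoff_in g B x : B x -> cutoff g B x = g x.
Proof. by move=> Bx; rewrite /cutoff indicE mem_set// mule1. Qed.

Lemma modular_cutoff r g A B (s : R) : measurable A -> measurable B -> (forall x, 1 <= r x)%R ->
  (0 < s)%R -> modular (leb R n) r A (cutoff g B) s = modular (leb R n) r (A `&` B) g s.
Proof. exact: modular_mul_indic. Qed.

Lemma lux_cutoff r g A B (s : R) : measurable A -> measurable B -> (forall x, 1 <= r x)%R ->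
  lux (leb R n) r A (cutoff g B) s <-> lux (leb R n) r (A `&` B) g s.
Proof. by move=> mA mB r1; split => -[s0 H]; split => //; move: H; rewrite modular_cutoff. Qed.

Lemma varnorm_cutoff_lux r g B (s : R) : measurable B ->
  measurable_fun setT r -> (forall x, 1 <= r x)%R -> measurable_fun setT g ->
  varnorm r (cutoff g B) < s%:E -> lux (leb R n) r B g s.
Proof.
move=> mB mr r1 mg H; rewrite -[B]setTI.
apply: (lux_cutoff g s measurableT mB r1).1.
exact: (varnorm_lt_lux mr r1 (measurable_cutoff mB mg) H).
Qed.

Lemma varnorm_cutoff_le r g A B : measurable A -> measurable B -> A `<=` B ->
  measurable_fun setT r -> (forall x, 1 <= r x)%R -> measurable_fun setT g ->
  varnorm r (cutoff g A) <= varnorm r (cutoff g B).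
Proof.
move=> mA mB AB mr r1 mg; apply: le_ereal_inf_tmp => _ [t [t0 Ht] <-].
apply: lux_varnorm; apply: (lux_cutoff g t measurableT mA r1).2; rewrite setTI.
apply: (lux_subset mr r1 mA mB AB mg); rewrite -[B]setTI.
by apply: (lux_cutoff g t measurableT mB r1).1; split.
Qed.

End VariableNorm.

Lemma neg_int_split (k : int) : k < 0 -> k != -1 ->
  exists m : nat, [/\ k + 1 = - m.+1%:Z, `|k|%N = m.+2 & k + 1 <= -1].
Proof. by move=> k0 k1; exists (`|k| - 2)%N; split; lia. Qed.

Lemma ln_2exprz (R : realType) (k : int) : ln ((2 : R) ^ k) = k%:~R * ln 2.
Proof. by rewrite -powR_intmul// ln_powR. Qed.

Section Exponents.
Context {R : realType} {n : nat}.
Implicit Types (p : Rn R n -> R).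

Lemma exp_inf_gt1 p : (1 < exp_inf p)%E -> exists2 p1, 1 < p1 & forall x, p1 <= p x.
Proof.
have H x : (exp_inf p <= (p x)%:E)%E by apply: ereal_inf_lbound; exists x.
move: H; case: (exp_inf p) => [a| |]// H.
- by rewrite lte_fin => a1; exists a => // x; have := H x; rewrite lee_fin.
- by have := H rn_origin; rewrite leye_eq.
Qed.

Lemma conj_expE p x : 1 < p x -> conj_exp p x = p x / (p x - 1).
Proof.
move=> p1; rewrite /conj_exp /hoelder_conjugate /= eqe gt_eqF ?(lt_trans _ p1)//.
by rewrite -EFinB inver gt_eqF ?subr_gt0.
Qed.

Lemma conj_exp_gt1 p x : 1 < p x -> 1 < conj_exp p x.
Proof. by move=> p1; rewrite conj_expE// ltr_pdivlMr ?subr_gt0// mul1r; lra. Qed.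

Lemma conj_exp_sum p x : 1 < p x -> (p x)^-1 + (conj_exp p x)^-1 = 1.
Proof.
move=> p1; rewrite conj_expE// invf_div; field.
by rewrite gt_eqF// (lt_trans _ p1).
Qed.

Lemma conj_exp_le p (a : R) x : 1 < a -> a <= p x -> conj_exp p x <= a / (a - 1).
Proof.
move=> a1 ap; have px := lt_le_trans a1 ap; rewrite conj_expE//.
rewrite ler_pdivrMr ?subr_gt0// mulrAC ler_pdivlMr ?subr_gt0//; nra.
Qed.

Lemma measurable_conj_exp p : measurable_fun setT p -> (forall x, 1 < p x) ->
  measurable_fun setT (conj_exp p).
Proof.
move=> mp p1; rewrite (_ : conj_exp p = fun x => p x / (p x - 1)).
  exact: measurable_conjugate.
by apply/funext => x; rewrite conj_expE.
Qed.

(** On the shell of index k both logarithms in the log-Hoelder conditions are comparable to 1 + |k|,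
    except at k = -1, where 1/2 <= |x| lies outside the range of [LH0] and boundedness of p is
    used. *)
Lemma exponent_on_shells p : variable_exponent p -> LH0 p -> LHoo p ->
  exists p0 poo L : R, [/\ 1 <= p0, 1 <= poo, 0 <= L &
    forall (k : int) x, shell k (k + 1) x ->
      `|p x - (if k < 0 then p0 else poo)| <= L / (1 + `|k|%N%:R)].
Proof.
move=> [mp p1 [M pM]] [C [p0 [C_gt0 p01 H0]]] [C' [poo [C'_gt0 poo1 Hoo]]].
have l2 : 0 < ln 2 :> R by rewrite ln_gt0// ltr1n.
have l21 : ln 2 <= 1 :> R by rewrite (le_trans (le_ln1Dx _)).
(* One summand for each of the cases k = -1, k <= -2 and k >= 0. The 3 comes from 1 + |k| <= 3(|k| -
   1) for k <= -2. *)
exists p0, poo, (2 * (M + p0) + 3 * C / ln 2 + 2 * C' / ln 2).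
have M1 : 1 <= M by apply: le_trans (pM rn_origin).
have c1 : 0 <= 3 * C / ln 2 by rewrite divr_ge0 ?mulr_ge0 ?ltW.
have c2 : 0 <= 2 * C' / ln 2 by rewrite divr_ge0 ?mulr_ge0 ?ltW.
split => //; first by lra.
move=> k x /andP[kx xk]; case: ltP => k0.
- have x0 : 0 < eucl_norm x by apply: lt_le_trans kx; rewrite exprz_gt0.
  have [->|k1] := eqVneq k (-1).
    have : `|p x - p0| <= M + p0 by rewrite ler_norml; have := pM x; have := p1 x; lra.
    rewrite (_ : 1 + _ = 2 :> R)//; lra.
  have [m [Em Ek k2]] := neg_int_split k0 k1.
  have le2 : eucl_norm x < 2^-1.
    by apply: (lt_le_trans xk); rewrite -[leRHS]/((2 : R) ^ (-1)) ler_eXz2l ?ltr1n.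
  apply: (le_trans (H0 x _)); first by rewrite x0 le2.
  have lx : ln (eucl_norm x) <= - (m.+1)%:R * ln 2.
    have <- : ln ((2 : R) ^ (k + 1)) = - (m.+1)%:R * ln 2.
      by rewrite ln_2exprz Em mulrNz.
    by rewrite ler_ln ?posrE ?exprz_gt0// ltW.
  have lx0 : 0 < - ln (eucl_norm x).
    by rewrite oppr_gt0 ln_lt0// x0 (lt_trans le2)// invf_lt1 ?ltr1n.
  rewrite ler_pdivlMr; last by rewrite ltr_pwDl.
  rewrite mulrAC ler_pdivrMr//.
  rewrite Ek.
  have m0 : 0 <= m%:R :> R by [].
  have E1 : C * (1 + m.+2%:R) <= 3 * C / ln 2 * ((m.+1)%:R * ln 2).
    rewrite mulrACA mulVf ?gt_eqF// mulr1 -!natr1; nra.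
  apply: (le_trans E1); apply: ler_pM => //; first by rewrite mulr_ge0// ltW.
  - by lra.
  - by lra.
- apply: (le_trans (Hoo x)).
  case: k k0 kx {xk} => // m _ kx.
  rewrite ler_pdivlMr; last by rewrite ltr_pwDl.
  have e1 : 1 < expR 1 + eucl_norm x :> R.
    by rewrite (lt_le_trans (y := expR 1))// ?expR_gt1// lerDl eucl_norm_ge0.
  (* Average of the lower bounds 1, which is at least ln 2, and m ln 2. *)
  have lg : (1 + m%:R) * ln 2 / 2 <= ln (expR 1 + eucl_norm x) :> R.
    have A1 : 1 <= ln (expR 1 + eucl_norm x) :> R.
      rewrite -{1}(expRK 1) ler_ln ?posrE ?expR_gt0//; last by rewrite (lt_trans _ e1).
      by rewrite lerDl eucl_norm_ge0.
    have A2 : m%:R * ln 2 <= ln (expR 1 + eucl_norm x).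
      rewrite -[m%:R]/((m%:Z)%:~R) -ln_2exprz.
      rewrite ler_ln ?posrE ?exprz_gt0//; last by rewrite (lt_trans _ e1).
      by rewrite (le_trans kx)// lerDr expR_ge0.
    lra.
  have lg0 : 0 < ln (expR 1 + eucl_norm x) by rewrite ln_gt0.
  rewrite mulrAC ler_pdivrMr//.
  rewrite absz_nat.
  have m0 : 0 <= m%:R :> R by [].
  have E1 : C' * (1 + m%:R) = 2 * C' / ln 2 * ((1 + m%:R) * ln 2 / 2).
    by field; rewrite gt_eqF.
  rewrite E1; apply: ler_pM => //.
  - by rewrite !mulr_ge0// ?addr_ge0// ltW.
  - by lra.
Qed.

End Exponents.

(** * Recombining the dyadic shells *)

Section IntSums.
Local Open Scope ereal_scope.
Context {R : realType}.

Lemma exchange_esum (I J : choiceType) (a : I -> J -> \bar R) :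
  (forall i j, 0 <= a i j) ->
  \esum_(i in [set: I]) \esum_(j in [set: J]) a i j =
  \esum_(j in [set: J]) \esum_(i in [set: I]) a i j.
Proof.
move=> a0; rewrite !esum_esum//.
rewrite [LHS](reindex_esum (setT `*`` (fun=> setT)) _ (fun x : J * I => (x.2, x.1)))//.
split; first by [].
- by move=> [i j] [i' j'] _ _ [-> ->].
- by move=> [i j] _; exists (j, i).
Qed.

Lemma esumZl (I : choiceType) (c : R) (a : I -> \bar R) :
  (0 <= c)%R -> (forall i, 0 <= a i) ->
  \esum_(i in [set: I]) (c%:E * a i) <= c%:E * \esum_(i in [set: I]) a i.
Proof.
move=> c0 a0; apply: ge_ereal_sup => _ [X [finX XI] <-].
rewrite fsbig_finite//= -ge0_sume_distrr//.
rewrite lee_wpmul2l ?lee_fin// esum_ge//; exists X => //.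
by rewrite fsbig_finite.
Qed.

Lemma esum_single (I : choiceType) (a : I -> \bar R) i : (forall j, 0 <= a j) ->
  a i <= \esum_(j in [set: I]) a j.
Proof.
move=> a0; apply: esum_ge; exists [set i]; first by split => //; exact: finite_set1.
by rewrite fsbig_set1.
Qed.

(** Across the sign change, where the reference exponents differ, the decay factor eta^|k-j| splits
    into a product that is summable in j and k separately. *)
Lemma absz_sub_opp (j k : int) : (j < 0)%R != (k < 0)%R ->
  (`|k - j| = `|k| + `|j|)%N.
Proof. by lia. Qed.

End IntSums.

Lemma norm_ln_half_pow (R : realType) (t : R) m : 2^-1 ^+ m / 2 <= t -> t <= 1 ->
  `|ln t| <= 1 + m%:R.
Proof.
move=> t0 t1; have l21 : ln 2 <= 1 :> R by rewrite (le_trans (le_ln1Dx _)).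
have h0 : 0 < 2^-1 ^+ m / 2 :> R by rewrite divr_gt0// exprn_gt0// invr_gt0.
rewrite ler0_norm ?ln_le0// lerNl; apply: (le_trans (y := ln (2^-1 ^+ m / 2))); last first.
  by rewrite ler_ln ?posrE// (lt_le_trans h0).
rewrite -exprSr lnXn ?invr_gt0// lnV ?posrE// mulNrn lerN2 nat1r.
by rewrite -[leLHS]mulr_natl ler_piMr.
Qed.

Lemma powR_le1 (R : realType) (a e : R) : 0 <= a <= 1 -> 0 <= e -> a `^ e <= 1.
Proof.
move=> /andP[a0 a1] e0; have -> : 1 = 1 `^ e :> R by rewrite powR1.
by rewrite ge0_ler_powR ?nnegrE.
Qed.

Section Glue.
Context d (T : measurableType d) (R : realType) (mu : {measure set T -> \bar R}).
Variables (p : T -> R) (I : int -> set T) (p0 poo L : R).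
Hypothesis mp : measurable_fun setT p.
Hypothesis p_ge1 : forall x, 1 <= p x.
Hypothesis mI : forall k, measurable (I k).
Hypothesis tI : trivIset setT I.
Hypothesis I_null : mu (~` \bigcup_k I k) = 0%E.
Hypotheses (p0_ge1 : 1 <= p0) (poo_ge1 : 1 <= poo) (L0 : 0 <= L).

Let P (k : int) := if k < 0 then p0 else poo.

Hypothesis pP : forall k x, I k x -> `|p x - P k| <= L / (1 + `|k|%N%:R).

Let P1 k : 1 <= P k. Proof. by rewrite /P; case: ifP. Qed.
Let P0 k : 0 < P k. Proof. exact: lt_le_trans (P1 k). Qed.

(** The purpose of the log-Hoelder conditions: ln t may grow like 1 + m while the exponent error
    decays like 1/(1 + m), so the product stays bounded. *)
Lemma powR_le_expR (t A a e : R) (m : nat) : 0 < t -> 0 <= A ->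
  `|ln t| <= A * (1 + m%:R) -> `|e| <= a / (1 + m%:R) -> t `^ e <= expR (A * a).
Proof.
move=> t0 A0 lt le; rewrite /powR gt_eqF// ler_expR.
apply: (le_trans (ler_norm _)); rewrite normrM mulrC.
have m0 : 0 < 1 + m%:R :> R by rewrite ltr_pwDl.
have : `|ln t| * `|e| <= (A * (1 + m%:R)) * (a / (1 + m%:R)).
  by apply: ler_pM.
by rewrite mulrACA mulrA mulfK ?gt_eqF.
Qed.

Lemma modular_bigcup F s : measurable_fun setT F -> 0 < s ->
  modular mu p setT F s = (\esum_(k in [set: int]) modular mu p (I k) F s)%E.
Proof.
move=> mF s0; apply: ge0_integral_conull_bigcup => //; first exact: measurable_modular.
by move=> x; exact: poweR_ge0.
Qed.

(* Variable-exponent norms over the shells are compared through the discrete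
   weights [alpha]: the lower bound [2^-|j|/2 <= beta j] keeps [ln (alpha j)]
   of size O(1+|j|), so that exchanging [p x] for [P j] costs a bounded factor. *)
Lemma shell_glue (eta : R) : 0 < eta < 1 ->
  exists2 C, 0 < C & forall F l, measurable_fun setT F -> lux mu p setT F l ->
  exists alpha tau : int -> R,
  [/\ forall j, 0 < alpha j, forall k, 0 < tau k,
      forall j, lux mu p (I j) F (C * (l * alpha j)),
      forall j k, eta ^+ `|k - j|%N * alpha j <= tau k &
      forall G D, 0 < D -> measurable_fun setT G ->
        (forall k, lux mu p (I k) G (D * tau k)) -> lux mu p setT G (C * D)].
Proof.
move=> eta01; have [S S1 HS] := esum_geometric_int eta01.
have half01 : 0 < (2^-1 : R) < 1 by apply/andP; split; lra.
have [S2 S21 HS2] := esum_geometric_int half01.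
have [eta0 eta1] := andP eta01; have S0 : 0 < S by lra.
(* The exponential pays for replacing p by [P k] in powers of [tau k]. In the bracket, S (1 + S2)/2
   bounds the pairs with j and k on the same side of 0, since the [beta j] sum to at most (1 +
   S2)/2, and S * S bounds the pairs on opposite sides. In [C], the term 2 expR L serves the
   lower-level claim on [alpha]. *)
pose C' := expR (S * L) * (S * ((1 + S2) / 2) + S * S).
have C'0 : 0 < C' by rewrite mulr_gt0 ?expR_gt0// addr_gt0 ?mulr_gt0//; lra.
pose C := 2 * expR L + C' + 1.
have C0 : 0 < C by rewrite !addr_gt0// mulr_gt0 ?expR_gt0.
exists C => // F l mF [l0 Hl].
have modE := modular_bigcup mF l0.
have le1 j : (modular mu p (I j) F l <= 1)%E.
  apply: le_trans Hl; rewrite modE; apply: (@esum_single _ _ (fun j => modular mu p (I j) F l)).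
  by move=> k; exact: modular_ge0.
pose b j := fine (modular mu p (I j) F l).
have bE j : modular mu p (I j) F l = (b j)%:E.
  by rewrite fineK// ge0_fin_numE ?modular_ge0// (le_lt_trans (le1 j))// ltry.
have b0 j : 0 <= b j by rewrite -lee_fin -bE modular_ge0.
have b1 j : b j <= 1 by rewrite -lee_fin -bE.
pose h j : R := 2^-1 ^+ `|j|%N.
have h0 j : 0 < h j by rewrite exprn_gt0// invr_gt0.
have h1 j : h j <= 1 by rewrite exprn_ile1// ?invr_ge0// invf_le1// ler1n.
pose beta j := (b j + h j) / 2.
have beta0 j : 0 < beta j by rewrite divr_gt0// ltr_wpDl.
have beta1 j : beta j <= 1 by rewrite ler_pdivrMr// mul1r; have := b1 j; have := h1 j; lra.
have bb j : b j <= 2 * beta j by rewrite mulrC divfK// lerDl ltW.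
have lnbeta j : `|ln (beta j)| <= 1 + `|j|%N%:R.
  by apply: norm_ln_half_pow => //; rewrite ler_pM2r ?invr_gt0// lerDr.
pose alpha j := beta j `^ (P j)^-1.
have alpha0 j : 0 < alpha j by exact: powR_gt0.
have alphaP j : alpha j `^ P j = beta j.
  by rewrite -powRrM mulVf ?gt_eqF// powRr1// ltW.
have alpha1 j : alpha j <= 1.
  by apply: powR_le1; rewrite ?invr_ge0 ?(ltW (P0 j)) ?(ltW (beta0 j)) ?beta1.
have lnalpha j : `|ln (alpha j)| <= 1 * (1 + `|j|%N%:R).
  rewrite ln_powR mul1r normrM ger0_norm ?invr_ge0 ?(ltW (P0 _))//.
  by rewrite (le_trans _ (lnbeta j))// ler_piMl// invf_le1.
(* The power is that of the target shell k, not of the source shell j. Each single term then bounds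
   [eta ^+ |k - j| * alpha j] after a root of order [P k], and the comparison of [P k] with [P j] is
   postponed to the double sum. *)
pose Q k := (\esum_(j in [set: int]) (eta ^+ `|k - j|%N * alpha j `^ P k)%:E)%E.
have term0 j k : (0 <= (eta ^+ `|k - j|%N * alpha j `^ P k)%:E)%E.
  by rewrite lee_fin mulr_ge0 ?powR_ge0// exprn_ge0// ltW.
have QS k : (Q k <= S%:E)%E.
  apply: le_trans (HS k); apply: le_esum => j _; rewrite lee_fin.
  rewrite ler_piMr ?exprn_ge0 ?(ltW eta0)//.
  by apply: powR_le1; rewrite ?(ltW (P0 k)) ?(ltW (alpha0 j)) ?alpha1.
have Qge j k : ((eta ^+ `|k - j|%N * alpha j `^ P k)%:E <= Q k)%E.
  exact: (@esum_single _ _ (fun j => (eta ^+ `|k - j|%N * alpha j `^ P k)%:E)).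
have QE k : Q k = (fine (Q k))%:E.
  by rewrite fineK// ge0_fin_numE ?(le_lt_trans (QS k)) ?ltry// (le_trans _ (Qge k k)).
pose q k := fine (Q k).
have qge j k : eta ^+ `|k - j|%N * alpha j `^ P k <= q k by rewrite -lee_fin /q -QE.
have qS k : q k <= S by rewrite -lee_fin /q -QE.
(* The diagonal term j = k; it carries the lower bound on [beta] over to [q], so that the logarithm
   of [tau k] is under control. *)
have betaq k : beta k <= q k.
  by have := qge k k; rewrite subrr absz0 expr0 mul1r alphaP.
have q0 k : 0 < q k by exact: lt_le_trans (betaq k).
pose tau k := q k `^ (P k)^-1.
have tau0 k : 0 < tau k by exact: powR_gt0.
have tauP k : tau k `^ P k = q k by rewrite -powRrM mulVf ?gt_eqF// powRr1// ltW.
have lntau k : `|ln (tau k)| <= S * (1 + `|k|%N%:R).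
  rewrite ln_powR normrM ger0_norm ?invr_ge0 ?(ltW (P0 _))//.
  rewrite (le_trans (y := `|ln (q k)|))//; first by rewrite ler_piMl// invf_le1.
  have k0 : 0 <= `|k|%N%:R :> R by [].
  rewrite ler_norml; apply/andP; split.
    apply: (le_trans (y := ln (beta k))); last by rewrite ler_ln ?posrE.
    have := lnbeta k; rewrite ler_norml => /andP[+ _]; apply: le_trans.
    by rewrite lerN2 ler_peMl// addr_ge0.
  apply: (le_trans (y := ln S)); first by rewrite ler_ln ?posrE.
  by apply: (le_trans (ltW (ln_sublinear S0))); rewrite ler_peMr ?lerDl// ltW.
exists alpha, tau; split => //.
- move=> j; apply: (@lux_le _ _ _ _ _ mp p_ge1 _ _ (2 * expR L * (l * alpha j))) => //.
    by rewrite ler_pM2r ?mulr_gt0// /C; lra.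
  have L1 : 1 <= 2 * expR L.
    by rewrite (le_trans (y := expR L)) -?expR0 ?ler_expR// ler_peMl ?expR_ge0// expR0 ler1n.
  apply: lux_modular_bound => //; first exact: mulr_gt0.
  (* Split p x into [P j] and an error: the first part gives 1 / [beta j] exactly, the second at
     most expR L. *)
  have cq x : I j x -> (alpha j)^-1 `^ p x <= (beta j)^-1 * expR L.
    move=> Ix; have -> : p x = P j + (p x - P j) by rewrite addrC subrK.
    rewrite powRD; last by rewrite invr_eq0 (gt_eqF (alpha0 j)) implybT.
    rewrite -powR_inv1 ?(ltW (alpha0 j))// powRAC alphaP powR_inv1 ?(ltW (beta0 j))//.
    rewrite ler_pM2l ?invr_gt0// -[L]mul1r; apply: (@powR_le_expR _ 1 _ _ `|j|%N) => //.
    + exact: powR_gt0.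
    + by rewrite ln_powR mulN1r normrN.
    + exact: pP.
  have bL0 : 0 <= (beta j)^-1 * expR L by rewrite mulr_ge0 ?expR_ge0// invr_ge0 ltW.
  rewrite (mulrC l); apply: (le_trans (modular_rescale mu mp p_ge1 (mI j) mF l0 (alpha0 j) cq bL0)).
  rewrite bE -EFinM lee_fin mulrAC ler_pM2r ?expR_gt0// mulrC ler_pdivrMr//.
- move=> j k; have e0 : 0 < eta ^+ `|k - j|%N by exact: exprn_gt0.
  have e1 : eta ^+ `|k - j|%N <= 1 by rewrite exprn_ile1// ltW.
  have H : (eta ^+ `|k - j|%N * alpha j) `^ P k <= q k.
    apply: le_trans (qge j k); rewrite powRM ?(ltW e0) ?(ltW (alpha0 j))//.
    rewrite ler_wpM2r ?powR_ge0//; apply: ge1r_powR => //.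
    by rewrite e0.
  rewrite -[leLHS](@powRr1 R); last by rewrite mulr_ge0 ?(ltW e0) ?(ltW (alpha0 j)).
  rewrite -(mulfV (lt0r_neq0 (P0 k))) powRrM ge0_ler_powR// ?nnegrE ?powR_ge0 ?(ltW (q0 k))//.
  by rewrite invr_ge0 ltW.
- move=> G D D0 mG HG.
  apply: (@lux_le _ _ _ _ _ mp p_ge1 _ _ ((C' + 1) * D)) => //.
    by rewrite ler_pM2r// /C; have := expR_gt0 L; lra.
  apply: lux_modular_bound => //; first by lra.
  apply: (le_trans (y := C'%:E)); last by rewrite lee_fin; lra.
  rewrite modular_bigcup//.
  have mk k : (modular mu p (I k) G D <= (expR (S * L))%:E * Q k)%E.
    have [D1 H1] := HG k.
    have cq x : I k x -> ((tau k)^-1)^-1 `^ p x <= q k * expR (S * L).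
      move=> Ix; have -> : p x = P k + (p x - P k) by rewrite addrC subrK.
      rewrite invrK powRD; last by rewrite (gt_eqF (tau0 k)) implybT.
      rewrite tauP ler_pM2l//; apply: (@powR_le_expR _ _ _ _ `|k|%N) => //; first exact: ltW.
      exact: pP.
    have DE : D = (tau k)^-1 * (D * tau k) by rewrite mulrCA mulVf ?mulr1// gt_eqF.
    rewrite {1}DE.
    have tV : 0 < (tau k)^-1 by rewrite invr_gt0.
    have qL0 : 0 <= q k * expR (S * L) by rewrite mulr_ge0 ?expR_ge0// ltW.
    apply: (le_trans (modular_rescale mu mp p_ge1 (mI k) mG D1 tV cq qL0)).
    rewrite QE -EFinM mulrC -[leRHS]mule1 lee_wpmul2l//.
    by rewrite lee_fin mulr_ge0 ?expR_ge0// ltW.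
  apply: (le_trans (le_esum (fun k _ => mk k))).
  apply: (le_trans (esumZl (expR_ge0 _) _)); first by move=> k; exact: le_trans (Qge k k).
  rewrite /C' EFinM lee_wpmul2l ?lee_fin ?expR_ge0//.
  (* The first summand dominates when j and k have the same sign, because then [alpha j] to the
     power [P k] is [beta j]; the second when the signs differ, because [alpha j] is at most 1. *)
  pose A k j := ((eta ^+ `|k - j|%N * beta j)%:E + (eta ^+ `|k|%N)%:E * (eta ^+ `|j|%N)%:E)%E.
  have A0 k j : (0 <= (eta ^+ `|k - j|%N * beta j)%:E)%E.
    by rewrite lee_fin mulr_ge0 ?exprn_ge0 ?ltW.
  have E0 k : (0 <= (eta ^+ `|k|%N)%:E)%E by rewrite lee_fin exprn_ge0 ?ltW.
  apply: (le_trans (y := \esum_(k in [set: int]) \esum_(j in [set: int]) A k j)%E).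
    apply: le_esum => k _; apply: le_esum => j _; rewrite /A -EFinM -EFinD lee_fin.
    have [PE|PN] := eqVneq (k < 0) (j < 0).
      have -> : P k = P j by rewrite /P PE.
      by rewrite alphaP lerDl mulr_ge0 ?exprn_ge0 ?ltW.
    rewrite absz_sub_opp; last by rewrite eq_sym.
    rewrite -exprD -[leLHS]add0r; apply: lerD.
      by apply: mulr_ge0; [rewrite exprn_ge0 ?(ltW eta0)|exact: ltW].
    rewrite ler_piMr ?exprn_ge0 ?(ltW eta0)//.
    by apply: powR_le1; rewrite ?(ltW (P0 k)) ?(ltW (alpha0 j)) ?alpha1.
  rewrite EFinD.
  apply: (le_trans (y := (\esum_(k in [set: int]) \esum_(j in [set: int])
       (eta ^+ `|k - j|%N * beta j)%:E
     + \esum_(k in [set: int]) \esum_(j in [set: int])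
       ((eta ^+ `|k|%N)%:E * (eta ^+ `|j|%N)%:E))%E)).
    rewrite -esumD//; last 2 first.
    + by move=> k _; exact: esum_ge0.
    + by move=> k _; apply: esum_ge0 => j _; exact: mule_ge0.
    apply: le_esum => k _; rewrite -esumD// => j _; exact: mule_ge0.
  have HS0 : (\esum_(k in [set: int]) (eta ^+ `|k|%N)%:E <= S%:E)%E.
    have := HS 0; rewrite (eq_esum (b := fun k : int => (eta ^+ `|k|%N)%:E))//.
    by move=> k _; rewrite sub0r abszN.
  apply: leeD.
    rewrite exchange_esum//.
    apply: (le_trans (y := \esum_(j in [set: int]) (S%:E * (beta j)%:E))%E).
      apply: le_esum => j _.
      under eq_esum do rewrite mulrC EFinM.
      apply: (le_trans (esumZl _ _)); first exact: ltW.
        by move=> i; rewrite lee_fin exprn_ge0 ?ltW.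
      rewrite muleC lee_wpmul2r ?lee_fin ?(ltW (beta0 j))//.
      apply: le_trans (HS j); apply: le_esum => k _.
      by rewrite distnC.
    apply: (le_trans (esumZl (ltW S0) _)); first by move=> j; rewrite lee_fin ltW.
    rewrite EFinM lee_wpmul2l ?lee_fin ?(ltW S0)//.
    have -> : (\esum_(j in [set: int]) (beta j)%:E =
       \esum_(j in [set: int]) ((2^-1)%:E * ((b j)%:E + (h j)%:E)))%E.
      by apply: eq_esum => j _; rewrite -EFinD -EFinM mulrC.
    apply: (le_trans (esumZl _ _)); first by rewrite invr_ge0.
      by move=> j; rewrite -EFinD lee_fin addr_ge0// ltW.
    rewrite mulrC EFinM lee_wpmul2l ?lee_fin ?invr_ge0//.
    rewrite esumD; [|by move=> j _; rewrite lee_fin|by move=> j _; rewrite lee_fin ltW].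
    rewrite EFinD; apply: leeD.
      by apply: le_trans Hl; rewrite modE; apply: le_esum => j _; rewrite bE.
    have := HS2 0; rewrite (eq_esum (b := fun k : int => (h k)%:E))//.
    by move=> k _; rewrite sub0r abszN.
  apply: (le_trans (y := \esum_(k in [set: int]) ((S%:E * (eta ^+ `|k|%N)%:E)))%E).
    apply: le_esum => k _; apply: (le_trans (esumZl _ _)) => //.
      by rewrite exprn_ge0 ?ltW.
    by rewrite muleC lee_wpmul2r.
  apply: (le_trans (esumZl (ltW S0) _)) => //.
  by rewrite EFinM lee_wpmul2l ?lee_fin ?(ltW S0).
Qed.

End Glue.

(** * Geometric decay of weighted ball norms *)

Section Decay.
Context d (T : measurableType d) (R : realType) (mu : {measure set T -> \bar R}).
(** Kept abstract because it is applied twice: to w with exponent p, and to the inverse of w with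
    the conjugate exponent. *)
Variables (q : T -> R) (qmax : R) (h : T -> \bar R) (I B : int -> set T).
Variables (N : int -> R) (c : R).
Hypothesis mq : measurable_fun setT q.
Hypothesis q_ge1 : forall x, 1 <= q x.
Hypothesis q_le : forall x, q x <= qmax.
Hypothesis mh : measurable_fun setT h.
Hypothesis mI : forall k, measurable (I k).
Hypothesis mB : forall k, measurable (B k).
Hypothesis tI : trivIset setT I.
Hypothesis IB : forall (m : int) (i : nat), I (m - i.+1%:Z) `<=` B m.
Hypothesis N0 : forall k, 0 < N k.
Hypothesis N_mono : forall m (i : nat), N (m - i%:Z) <= N m.
Hypothesis N_lux : forall m l, N m < l -> lux mu q (B m) h l.
Hypothesis c1 : 1 <= c.
Hypothesis N_shell : forall m s, lux mu q (I (m - 1)) h s -> N m <= c * s.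

(* Doubling: among many disjoint shells inside [B m], each already carries a
   fixed fraction of the norm of the innermost ball, so their modulars add up. *)
Lemma norm_doubling : exists l : nat, forall m, 2 * N (m - l%:Z) <= N m.
Proof.
have c0 : 0 < c by exact: lt_le_trans c1.
have c41 : 1 <= 4 * c by have := c1; lra.
pose E := (4 * c) `^ qmax.
have E0 : 0 < E by apply: powR_gt0; lra.
exists (Num.bound E) => m; set l := Num.bound E.
have lE : E < l%:R by exact/archi_boundP/ltW.
rewrite leNgt; apply/negP => Nm.
have [s0 Hl] := N_lux Nm.
(* At this level an admissible shell norm would give N (m - i) <= N (m - l) / 2, against
   monotonicity; so each of the l shells has modular at least 1. Passing to 4 c s = 2 N (m - l)
   divides it by at most E, and l > E shells together exceed 1. *)
pose s := N (m - l%:Z) / (2 * c).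
have sp : 0 < s by rewrite divr_gt0// mulr_gt0.
have sE : 2 * N (m - l%:Z) = 4 * c * s by rewrite /s; field; rewrite gt_eqF.
have low (i : nat) : (i < l)%N -> ((E^-1)%:E <= modular mu q (I (m - i.+1%:Z)) h (4 * c * s))%E.
  move=> il; have : (1 <= modular mu q (I (m - i.+1%:Z)) h s)%E.
    rewrite leNgt; apply/negP => H.
    have H1 : lux mu q (I (m - i%:Z - 1)) h s.
      split => //; rewrite (_ : m - i%:Z - 1 = m - i.+1%:Z) ?ltW//.
      by rewrite -addrA -opprD; congr (_ - _); rewrite -PoszD addn1.
    have := N_shell H1; rewrite leNgt => /negP; apply.
    have cs : c * s = N (m - l%:Z) / 2 by rewrite /s; field; rewrite gt_eqF.
    rewrite cs; have : N (m - l%:Z) <= N (m - i%:Z).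
      have := N_mono (m - i%:Z) (l - i); rewrite -addrA -opprD -PoszD subnKC//.
      exact: ltnW.
    by have := N0 (m - l%:Z); lra.
  move=> /le_trans/(_ (modular_grow mu mq q_ge1 (mI _) mh sp c41 (fun x _ => q_le x))).
  rewrite -/E => H; rewrite -[leLHS]mule1 -(@lee_pmul2l _ E%:E) ?lte_fin//.
  by rewrite mule1 -EFinM mulfV// gt_eqF.
have : (1 < modular mu q (B m) h (4 * c * s))%E.
  pose F (i : nat) := I (m - i.+1%:Z).
  have tF : trivIset setT F.
    move=> i j _ _ Fij.
    have := tI (Logic.I : setT (m - i.+1%:Z)) (Logic.I : setT (m - j.+1%:Z)) Fij.
    by move=> /addrI/oppr_inj [].
  have ss0 : 0 < 4 * c * s by rewrite -sE.
  apply: (lt_le_trans (y := modular mu q (\big[setU/set0]_(i <- iota 0 l) F i) h (4 * c * s))).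
    rewrite /modular ge0_integral_bigsetU//.
    - rewrite big_seq.
      apply: (lt_le_trans (y := (\sum_(i <- iota 0 l | i \in iota 0 l) (E^-1)%:E)%E)).
        rewrite -big_seq sumEFin big_const_seq count_predT size_iota iter_addr_0.
        by rewrite lte_fin -mulr_natl ltr_pdivlMr// mul1r.
      by apply: lee_sum => i; rewrite mem_iota add0n => /andP[_ il]; exact: low.
    - by move=> i; exact: mI.
    - exact: iota_uniq.
    - by apply: sub_trivIset tF.
    - exact: measurable_modular.
    - by move=> x _; exact: poweR_ge0.
  apply: modular_subset => //.
  - by apply: bigsetU_measurable => i _; exact: mI.
  - by rewrite -bigcup_seq => x [i _ Fx]; exact: (IB Fx).
by rewrite -sE ltNge => /negP; apply.
Qed.

(** Iterated halving every l steps gives the rate theta = 2^(-1/l); the leading 2 absorbs the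
    remainder of i modulo l. *)
Lemma norm_decay : exists2 theta : R, 0 < theta < 1 &
  forall m (i : nat), N (m - i%:Z) <= 2 * theta ^+ i * N m.
Proof.
have [l0 Hl0] := norm_doubling.
have [l l_gt0 Hl] : exists2 l : nat, (0 < l)%N & forall m, 2 * N (m - l%:Z) <= N m.
  case: l0 Hl0 => [H|l H]; last by exists l.+1.
  by have := H 0; have := N0 0; rewrite subr0; lra.
pose theta : R := 2 `^ (- (l%:R)^-1).
have lp : 0 < l%:R :> R by rewrite ltr0n.
have t0 : 0 < theta by exact: powR_gt0.
have t1 : theta < 1.
  rewrite /theta /powR pnatr_eq0 /= expR_lt1 mulNr oppr_lt0.
  by rewrite mulr_gt0 ?invr_gt0 ?ln_gt0 ?ltr1n.
exists theta; first by rewrite t0.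
have tl : theta ^+ l = 2^-1.
  by rewrite -powR_mulrn ?ltW// /theta -powRrM mulNr mulVf ?gt_eqF// powR_inv1.
have key s m : N (m - (l * s)%N%:Z) <= 2^-1 ^+ s * N m.
  elim: s m => [|s IH] m; first by rewrite muln0 subr0 mul1r.
  rewrite mulnS PoszD opprD addrA exprSr -mulrA (le_trans (IH _))//.
  rewrite ler_wpM2l ?exprn_ge0 ?invr_ge0//.
  by have := Hl m; lra.
move=> m i; rewrite {1 2}(divn_eq i l) exprD mulnC PoszD opprD addrA.
apply: (le_trans (N_mono _ _)); apply: (le_trans (key _ _)).
rewrite ler_pM2r// exprM tl mulrCA ler_peMr ?exprn_ge0 ?invr_ge0//.
have : 2^-1 <= theta ^+ (i %% l).
  rewrite -tl ler_wiXn2l//; [exact: ltW|exact: ltW|].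
  by rewrite ltnW// ltn_mod.
lra.
Qed.

End Decay.

Section LuxLower.
Local Open Scope ereal_scope.
Context d (T : measurableType d) (R : realType) (mu : {measure set T -> \bar R}).

(** If l < c a then l < c because a <= 1. On A the ratio |g|/l is then at least c/l > 1, which a
    power r >= 1 only increases, so the modular is at least (c/l) a > 1. *)
Lemma lux_lower (r : T -> R) (g : T -> \bar R) (A : set T) (l c a : R) :
  measurable_fun setT r -> (forall x, 1 <= r x)%R -> measurable_fun setT g ->
  measurable A -> (forall x, A x -> c%:E <= `|g x|) -> (0 < c)%R -> (0 < a <= 1)%R ->
  a%:E <= mu A -> lux mu r setT g l -> (c * a <= l)%R.
Proof.
move=> mr r1 mg mA cg c0 /andP[a0 a1] aA [l0 Hl]; rewrite leNgt; apply/negP => lca.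
have lc : (l < c)%R by rewrite (lt_le_trans lca)// ler_piMr// ltW.
have : (c / l)%:E * mu A <= 1.
  apply: le_trans Hl; apply: le_trans (modular_subset mu mr r1 mA measurableT _ mg l0) => //.
  rewrite -integral_cst//; apply: ge0_le_integral => //.
  - by move=> x _; rewrite lee_fin divr_ge0// ltW.
  - exact: measurable_modular.
  move=> x Ax; apply: (@le_trans _ _ ((c / l)%:E `^ r x)).
    by rewrite poweR_EFin lee_fin le1r_powR// ler_pdivlMr// mul1r ltW.
  apply: ge0_ler_poweR; first by rewrite (le_trans _ (r1 x)).
    by rewrite lee_fin divr_ge0// ltW.
  by rewrite dive_pos// EFinM lee_wpmul2r ?lee_fin ?invr_ge0 ?(ltW l0)// cg.
apply/negP; rewrite -ltNge; apply: (lt_le_trans (y := (c / l)%:E * a%:E)).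
  by rewrite -EFinM lte_fin mulrAC ltr_pdivlMr// mul1r.
by rewrite lee_wpmul2l// lee_fin divr_ge0// ltW.
Qed.

Lemma ae_nonempty (P : T -> Prop) (A : set T) : measurable A -> 0 < mu A ->
  {ae mu, forall x, P x} -> exists2 x, A x & P x.
Proof.
move=> mA A0 [Z [mZ Z0 HZ]]; apply: contrapT => H.
have AZ : A `<=` Z by move=> x Ax; apply: HZ => /= Px; apply: H; exists x.
have := le_measure mu; move=> /(_ A Z); rewrite !inE => /(_ mA mZ AZ) AZ'.
by move: A0; rewrite ltNge -Z0 AZ'.
Qed.

End LuxLower.

Lemma sqrt_geometric (R : realType) (t : R) : 0 < t < 1 ->
  exists2 eta : R, 0 < eta < 1 & eta ^+ 2 = t.
Proof.
move=> /andP[t0 t1]; exists (Num.sqrt t); last by rewrite sqr_sqrtr// ltW.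
by rewrite sqrtr_gt0 t0 /= -sqrtr1 ltr_sqrt.
Qed.

Lemma int_le_split (j k : int) : j <= k ->
  exists i : nat, [/\ k = j + i%:Z, `|k - j|%N = i & k + 1 - i%:Z = j + 1].
Proof. by move=> jk; exists `|k - j|%N; split; lia. Qed.

Lemma subz_succ_le (m : int) (i : nat) : m - i.+1%:Z + 1 <= m.
Proof. by lia. Qed.

(** * Off-diagonal decay for a weight and its inverse on dyadic shells *)

Section Weight.
Context {R : realType} {n : nat} (hn : (0 < n)%N).
Variables (p : Rn R n -> R) (w : Rn R n -> \bar R) (C1 : R).
Hypothesis mp : measurable_fun setT p.
Hypothesis hpinf : (1 < exp_inf p)%E.
Variable pmax : R.
Hypothesis p_le : forall x, p x <= pmax.
Hypothesis mw : measurable_fun setT w.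
Hypothesis w_ae : {ae leb R n, forall x, (0 < w x < +oo)%E}.
Hypothesis hwA : Ap0 p w.
Hypothesis hC1 : 0 < C1.
Hypothesis hwC1 : forall k : int,
      (ereal_sup [set w x | x in dyadic_annulus k] <=
       C1%:E * ereal_inf [set w x | x in dyadic_annulus k])%E.

Lemma leb_shell_gt0 (k : int) : (0 < leb R n (shell k (k + 1)))%E.
Proof.
apply: (lt_le_trans _ (leb_shell_ge (R := R) k hn)).
by rewrite lte_fin exprn_gt0// divr_gt0 ?exprz_gt0// sqrtr_gt0 ltr0n.
Qed.

Lemma shell_annulus (k : int) : @shell R n (k - 1) (k + 2) `<=` dyadic_annulus (k + 1).
Proof.
move=> x /andP[H1 H2]; rewrite /dyadic_annulus /=.
rewrite (_ : k + 1 - 2 = k - 1); last by rewrite -addrA.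
by rewrite H1 (_ : k + 1 + 1 = k + 2) ?(ltW H2)// -addrA.
Qed.

Lemma shell_subset (i j i' j' : int) : i' <= i -> j <= j' ->
  @shell R n i j `<=` shell i' j'.
Proof.
move=> ii jj x /andP[H1 H2]; rewrite /shell /=.
rewrite (le_trans _ H1) ?ler_2exprz//= (lt_le_trans H2)// ler_2exprz//.
Qed.

(** Here m is the infimum of w over the annulus of index k + 1. The shell has positive measure,
    hence contains a point where 0 < w < +oo; this makes the supremum positive, so the infimum is
    positive too, and finite. The bounds hold at every point, not merely almost everywhere. *)
Lemma weight_on_shell (k : int) : exists2 m : R, 0 < m &
  forall x, shell (k - 1) (k + 2) x -> (m%:E <= w x <= (C1 * m)%:E)%E.
Proof.
have [x0 Ax0 /andP[w0 wy]] :=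
  ae_nonempty (@measurable_shell R n k (k + 1)) (leb_shell_gt0 k) w_ae.
set A : set (Rn R n) := dyadic_annulus (k + 1).
have Ax : A x0.
  apply: shell_annulus; apply: shell_subset Ax0; first by rewrite gerBl.
  by rewrite lerD2l.
have infx x : A x -> (ereal_inf [set w x | x in A] <= w x)%E.
  by move=> H; apply: ereal_inf_lbound; exists x.
have supx x : A x -> (w x <= ereal_sup [set w x | x in A])%E.
  by move=> H; apply: ereal_sup_ubound; exists x.
have := hwC1 (k + 1); rewrite -/A => H.
have : (0 < C1%:E * ereal_inf [set w x | x in A])%E.
  by rewrite (lt_le_trans w0)// (le_trans (supx _ Ax)).
have := infx _ Ax.
move: infx H; case: ereal_inf => [m| |].
- move=> infx H _; rewrite -EFinM lte_fin pmulr_rgt0// => m0; exists m => // x /shell_annulus Dx.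
  by rewrite infx//= (le_trans (supx _ Dx)).
- by move=> _ _; rewrite leye_eq => /eqP wE; rewrite wE in wy.
- by move=> _ _ _; rewrite gt0_muleNy ?lte_fin.
Qed.

Let q := conj_exp p.

Let p_gt1 x : 1 < p x.
Proof. by have [p1 p11 H] := exp_inf_gt1 hpinf; exact: lt_le_trans (H x). Qed.

Let p_ge1 x : 1 <= p x. Proof. exact/ltW/p_gt1. Qed.

Let q_ge1 x : 1 <= q x. Proof. exact/ltW/conj_exp_gt1/p_gt1. Qed.

Let mq : measurable_fun setT q. Proof. exact: measurable_conj_exp. Qed.

Let q_le : exists qmax, forall x, q x <= qmax.
Proof.
have [p1 p11 H] := exp_inf_gt1 hpinf; exists (p1 / (p1 - 1)) => x.
exact: conj_exp_le.
Qed.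

Let winv x := ((w x)^-1)%E.

Let ball (m : int) := eucl_ball (@rn_origin R n) (2 ^ m).

Lemma shell_ball (m : int) (i : nat) :
  @shell R n (m - i.+1%:Z) (m - i.+1%:Z + 1) `<=` ball m.
Proof.
move=> x /andP[_ H]; rewrite /ball /eucl_ball/= eucl_distC (lt_le_trans H)//.
by rewrite ler_2exprz subz_succ_le.
Qed.

Let mball m : measurable (ball m). Proof. exact: measurable_eucl_ball. Qed.

Let mshell i j : measurable (@shell R n i j). Proof. exact: measurable_shell. Qed.

Let mwinv : measurable_fun setT winv. Proof. exact: measurable_inve_fun. Qed.

Let w_shell (k : int) : exists2 m : R, 0 < m &
  forall x, shell k (k + 1) x -> (m%:E <= w x <= (C1 * m)%:E)%E.
Proof.
have [m m0 H] := weight_on_shell k; exists m => // x Ix; apply: H.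
by apply: shell_subset Ix; [rewrite gerBl|rewrite lerD2l].
Qed.

Let M (k : int) := varnorm p (cutoff w (ball k)).
Let N (k : int) := varnorm q (cutoff winv (ball k)).

Let leb_shell_lower (k : int) : exists2 a : R, 0 < a <= 1 &
  (a%:E <= leb R n (shell k (k + 1)))%E.
Proof.
exists (Num.min 1 ((2 ^ k / Num.sqrt n%:R) ^+ n)).
  rewrite lt_min ltr01 ge_min lexx /= andbT exprn_gt0// divr_gt0 ?exprz_gt0//.
  by rewrite sqrtr_gt0 ltr0n.
by apply: (le_trans _ (leb_shell_ge k hn)); rewrite lee_fin ge_min lexx orbT.
Qed.

Let varnorm_cutoff_gt0 (r : Rn R n -> R) g (k : int) (c : R) :
  measurable_fun setT r -> (forall x, 1 <= r x) -> measurable_fun setT g ->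
  0 < c -> (forall x, shell (k - 1) (k - 1 + 1) x -> (c%:E <= `|g x|)%E) ->
  (0 < varnorm r (cutoff g (ball k)))%E.
Proof.
move=> mr r1 mg c0 cg; have [a a01 aA] := leb_shell_lower (k - 1).
have [a0 a1] := andP a01.
apply: (@lt_le_trans _ _ (c * a)%:E); first by rewrite lte_fin mulr_gt0.
apply: le_ereal_inf_tmp => _ [t [t0 Ht] <-]; rewrite lee_fin.
apply: (lux_lower mr r1 (measurable_cutoff (mball k) mg) (mshell _ _) _ c0 a01 aA (conj t0 Ht)).
by move=> x Ix; rewrite cutoff_in; [exact: cg|exact: (@shell_ball k 0)].
Qed.

Let M_gt0 k : (0 < M k)%E.
Proof.
have [m m0 H] := w_shell (k - 1).
apply: (varnorm_cutoff_gt0 mp p_ge1 mw m0) => x /H /andP[H1 _].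
by rewrite gee0_abs// (le_trans _ H1)// lee_fin ltW.
Qed.

Let N_gt0 k : (0 < N k)%E.
Proof.
have [m m0 H] := w_shell (k - 1).
have Cm0 : 0 < (C1 * m)^-1 by rewrite invr_gt0 mulr_gt0.
apply: (varnorm_cutoff_gt0 mq q_ge1 mwinv Cm0) => x /H /andP[].
rewrite /winv; case: (w x) => [t| |]//; rewrite !lee_fin => H1 H2.
have t0 : 0 < t by exact: lt_le_trans H1.
by rewrite inver gt_eqF//= lee_fin ger0_norm ?invr_ge0 ?(ltW t0)// lef_pV2// posrE mulr_gt0.
Qed.

Let MN_le : exists2 C : R, 0 < C &
  forall k, (M k * N k <= (C * (2 ^ k) ^+ n)%:E)%E.
Proof. by have [C [C0 H]] := hwA; exists C => // k; apply: H; rewrite exprz_gt0. Qed.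

(** The A_{p,0} condition bounds only the product M k * N k. Since both factors are positive, the
    convention 0 * +oo = 0 cannot hide an infinite one. *)
Let M_fin k : M k = (fine (M k))%:E.
Proof.
have [C C0 /(_ k)] := MN_le; move: (M_gt0 k) (N_gt0 k).
case: (M k) => [m| |]// _ N0; by rewrite gt0_mulye.
Qed.

Let N_fin k : N k = (fine (N k))%:E.
Proof.
have [C C0 /(_ k)] := MN_le; move: (M_gt0 k) (N_gt0 k).
case: (N k) => [m| |]// M0 _; by rewrite gt0_muley.
Qed.

Let fM k := fine (M k).
Let fN k := fine (N k).

Let fM_gt0 k : 0 < fM k. Proof. by rewrite -lte_fin -M_fin. Qed.
Let fN_gt0 k : 0 < fN k. Proof. by rewrite -lte_fin -N_fin. Qed.

Let M_lux k l : fM k < l -> lux (leb R n) p (ball k) w l.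
Proof.
rewrite -lte_fin -M_fin; exact: (varnorm_cutoff_lux (mball k) mp p_ge1 mw).
Qed.

Let N_lux k l : fN k < l -> lux (leb R n) q (ball k) winv l.
Proof.
rewrite -lte_fin -N_fin; exact: (varnorm_cutoff_lux (mball k) mq q_ge1 mwinv).
Qed.

Let ball_subset (m : int) (i : nat) : ball (m - i%:Z) `<=` ball m.
Proof.
by move=> x; rewrite /ball /eucl_ball/= => H; rewrite (lt_le_trans H)// ler_2exprz gerBl.
Qed.

Let fM_mono m (i : nat) : fM (m - i%:Z) <= fM m.
Proof. have := varnorm_cutoff_le (mball _) (mball _) (@ball_subset m i) mp p_ge1 mw.
by rewrite -/(M (m - i%:Z)) -/(M m) (M_fin (m - i%:Z)) (M_fin m) lee_fin. Qed.

Let fN_mono m (i : nat) : fN (m - i%:Z) <= fN m.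
Proof. have := varnorm_cutoff_le (mball _) (mball _) (@ball_subset m i) mq q_ge1 mwinv.
by rewrite -/(N (m - i%:Z)) -/(N m) (N_fin (m - i%:Z)) (N_fin m) lee_fin. Qed.

(** Hoelder's inequality for the product of w and its inverse, which is 1 everywhere on the shell;
    the integral is the volume of the shell. *)
Let hoelder_shell k s t : lux (leb R n) p (shell k (k + 1)) w s ->
  lux (leb R n) q (shell k (k + 1)) winv t ->
  ((2 ^ k / Num.sqrt n%:R) ^+ n) <= 2 * s * t :> R.
Proof.
move=> Hs Ht; rewrite -lee_fin; apply: (le_trans (leb_shell_ge k hn)).
have q_gt1 x : 1 < q x by exact/conj_exp_gt1/p_gt1.
apply: le_trans (modular_hoelder (mshell _ _) mp mq p_gt1 q_gt1
  (fun x => conj_exp_sum (p_gt1 x)) mw mwinv Hs Ht).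
rewrite -[leLHS]mul1e -integral_cst//.
rewrite le_eqVlt; apply/orP; left; apply/eqP.
have [m m0 H] := w_shell k.
apply: eq_integral => x; rewrite inE => /H /andP[].
rewrite /winv; case: (w x) => [a| |]//; rewrite !lee_fin => H1 _.
have a0 : 0 < a by exact: lt_le_trans H1.
by rewrite inver gt_eqF//= -EFinM !ger0_norm ?invr_ge0 ?(ltW a0)// mulfV// gt_eqF.
Qed.

(* A_{p,0} bounds [M m * N m] above and Hoelder on the outermost shell of [ball m]
   bounds it below, both by 2^(mn); so that shell alone carries a fixed fraction of
   either ball norm. *)
Let MN_shell : exists2 c : R, 1 <= c & forall m,
  (forall s, lux (leb R n) p (shell (m - 1) (m - 1 + 1)) w s -> fM m <= c * s) /\
  (forall s, lux (leb R n) q (shell (m - 1) (m - 1 + 1)) winv s -> fN m <= c * s).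
Proof.
have [C C0 HC] := MN_le.
pose c0 := (2 * Num.sqrt n%:R) ^- n : R.
have sq0 : 0 < Num.sqrt n%:R :> R by rewrite sqrtr_gt0 ltr0n.
have c00 : 0 < c0 by rewrite invr_gt0 exprn_gt0// mulr_gt0.
have vol m : (2 ^ (m - 1) / Num.sqrt n%:R) ^+ n = c0 * (2 ^ m) ^+ n :> R.
  rewrite /c0 -exprVn -exprMn; congr (_ ^+ _).
  by rewrite expfzDr// invfM exprN1; ring.
have MN' m : fM m * fN m <= C * (2 ^ m) ^+ n.
  by have := HC m; rewrite M_fin N_fin -EFinM lee_fin.
have sub m : @shell R n (m - 1) (m - 1 + 1) `<=` ball m by exact: (@shell_ball m 0).
(* C comes from A_{p,0} and c0 from the volume of the outermost shell. The 4 is the constant 2 of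
   Hoelder's inequality times the 2 that makes twice the complementary ball norm admissible; the
   summand 1 ensures c >= 1. *)
exists (1 + 4 * C / c0); first by rewrite lerDl divr_ge0 ?mulr_ge0 ?ltW.
have fin x y s b : 0 < x -> 0 < s -> y * x <= C * b -> c0 * b <= 2 * s * (2 * x) ->
    y <= (1 + 4 * C / c0) * s.
  move=> x0 s0 H1 H2; rewrite -(ler_pM2r x0) (le_trans H1)//.
  apply: (le_trans (y := C * (4 * s * x / c0))).
    by rewrite ler_pM2l// ler_pdivlMr// mulrC (le_trans H2)//; lra.
  have -> : C * (4 * s * x / c0) = 4 * C / c0 * s * x by ring.
  rewrite ler_pM2r// ler_pM2r// lerDr//.
move=> m; split => s Hs.
- have s0 := Hs.1; apply: (fin (fN m) _ s ((2 ^ m) ^+ n)) => //.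
  have HN : lux (leb R n) q (shell (m - 1) (m - 1 + 1)) winv (2 * fN m).
    apply: (lux_subset mq q_ge1 (mshell _ _) (mball _) (sub m) mwinv).
    by apply: N_lux; rewrite ltr_pMl// ltr1n.
  by have := hoelder_shell Hs HN; rewrite vol.
- have s0 := Hs.1; apply: (fin (fM m) _ s ((2 ^ m) ^+ n)) => //; first by rewrite mulrC.
  have HM : lux (leb R n) p (shell (m - 1) (m - 1 + 1)) w (2 * fM m).
    apply: (lux_subset mp p_ge1 (mshell _ _) (mball _) (sub m) mw).
    by apply: M_lux; rewrite ltr_pMl// ltr1n.
  by have := hoelder_shell HM Hs; rewrite vol; lra.
Qed.

(** The norm belonging to the smaller of the two indices is first compared, by geometric decay, with
    the norm over the larger ball; A_{p,0} is then applied on that ball alone. *)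
Lemma weight_decay : exists (u v : int -> R) (K eta : R),
  [/\ 0 < K /\ 0 < eta < 1, forall k, 0 < u k /\ 0 < v k,
      forall k, lux (leb R n) p (shell k (k + 1)) w (u k),
      forall k, lux (leb R n) q (shell k (k + 1)) winv (v k) &
      forall j k, u k * v j <= K * (2 ^ Num.max j k) ^+ n * (eta ^+ `|k - j|%N) ^+ 2].
Proof.
have [C C0 HC] := MN_le.
have MN' m : fM m * fN m <= C * (2 ^ m) ^+ n.
  by have := HC m; rewrite M_fin N_fin -EFinM lee_fin.
have [c c1 Hc] := MN_shell.
have [qmax qle] := q_le.
have tS : trivIset setT (fun k : int => @shell R n k (k + 1)) by exact: trivIset_shell.
have [t1 t101 Ht1] := norm_decay mp p_ge1 p_le mw (fun k => mshell k (k + 1)) mball tS shell_ball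
  fM_gt0 fM_mono M_lux c1 (fun m => (Hc m).1).
have [t2 t201 Ht2] := norm_decay mq q_ge1 qle mwinv (fun k => mshell k (k + 1)) mball tS shell_ball
  fN_gt0 fN_mono N_lux c1 (fun m => (Hc m).2).
pose t := Num.max t1 t2.
have t01 : 0 < t < 1.
  by move: t101 t201 => /andP[a1 a2] /andP[b1 b2]; rewrite lt_max gt_max a1 a2 b2.
have [eta eta01 etaE] := sqrt_geometric t01.
(* The ball of radius 2^(k+1) contains the shell of index k, and doubling its norm makes it
   admissible. The 8 collects the two doublings and the 2 of the decay estimate; 2^n comes from the
   radius 2^(k+1) in place of 2^k. *)
exists (fun k => 2 * fM (k + 1)), (fun k => 2 * fN (k + 1)), (8 * C * 2 ^+ n), eta.
have sub k : @shell R n k (k + 1) `<=` ball (k + 1).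
  by have := @shell_ball (k + 1) 0; rewrite addrK.
split.
- by rewrite eta01; split => //; rewrite !mulr_gt0// exprn_gt0.
- by move=> k; have := fM_gt0 (k + 1); have := fN_gt0 (k + 1); split; exact: mulr_gt0.
- move=> k; apply: (lux_subset mp p_ge1 (mshell _ _) (mball _) (sub k) mw).
  by apply: M_lux; rewrite ltr_pMl// ltr1n.
- move=> k; apply: (lux_subset mq q_ge1 (mshell _ _) (mball _) (sub k) mwinv).
  by apply: N_lux; rewrite ltr_pMl// ltr1n.
have two k : (2 ^ (k + 1)) ^+ n = 2 ^+ n * (2 ^ k) ^+ n :> R.
  by rewrite -exprMn expfzDr// expr1z mulrC.
move=> j k; rewrite -exprM mulnC exprM etaE.
have t0 : 0 < t by case/andP: t01.
have [t1p t2p] : 0 < t1 /\ 0 < t2 by case/andP: t101; case/andP: t201.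
have X1 i : t1 ^+ i <= t ^+ i.
  by apply: lerXn2r; rewrite ?nnegrE ?(ltW t1p) ?(ltW t0)// le_max lexx.
have X2 i : t2 ^+ i <= t ^+ i.
  by apply: lerXn2r; rewrite ?nnegrE ?(ltW t2p) ?(ltW t0)// le_max lexx orbT.
have [jk|kj] := leP j k.
- have [i [kE -> jE]] := int_le_split jk.
  have N1 : fN (j + 1) <= 2 * t ^+ i * fN (k + 1).
    have := Ht2 (k + 1) i; rewrite jE.
    move=> /le_trans; apply; rewrite ler_pM2r// ler_pM2l//.
  apply: (le_trans (y := 2 * fM (k + 1) * (2 * (2 * t ^+ i * fN (k + 1))))).
    by rewrite ler_pM2l ?mulr_gt0// ler_pM2l.
  apply: (le_trans (y := 8 * t ^+ i * (C * (2 ^ (k + 1)) ^+ n))); last first.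
    by rewrite two le_eqVlt; apply/orP; left; apply/eqP; ring.
  rewrite (_ : 2 * fM (k + 1) * (2 * (2 * t ^+ i * fN (k + 1))) =
    8 * t ^+ i * (fM (k + 1) * fN (k + 1))); last by ring.
  by rewrite ler_pM2l// mulr_gt0// exprn_gt0.
- have [i [jE ijE kE]] := int_le_split (ltW kj).
  rewrite distnC ijE.
  have M1 : fM (k + 1) <= 2 * t ^+ i * fM (j + 1).
    have := Ht1 (j + 1) i; rewrite kE.
    move=> /le_trans; apply; rewrite ler_pM2r// ler_pM2l//.
  apply: (le_trans (y := 2 * (2 * t ^+ i * fM (j + 1)) * (2 * fN (j + 1)))).
    by rewrite ler_pM2r ?mulr_gt0// ler_pM2l.
  apply: (le_trans (y := 8 * t ^+ i * (C * (2 ^ (j + 1)) ^+ n))); last first.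
    by rewrite two le_eqVlt; apply/orP; left; apply/eqP; ring.
  rewrite (_ : 2 * (2 * t ^+ i * fM (j + 1)) * (2 * fN (j + 1)) =
    8 * t ^+ i * (fM (j + 1) * fN (j + 1))); last by ring.
  by rewrite ler_pM2l// mulr_gt0// exprn_gt0.
Qed.

End Weight.

(** * Principal values and far parts of kernels *)

Section Truncations.
Context d (T : measurableType d) (R : realType) (mu : {measure set T -> \bar R}).

Lemma preimage_mem_true (D : set T) : (fun y => y \in D) @^-1` [set true] = D.
Proof. by apply/seteqP; split => y /=; [exact: set_mem|exact: mem_set]. Qed.

Lemma measurable_fun_mem (D : set T) : measurable D -> measurable_fun setT (fun y => y \in D).
Proof.
by move=> mD; apply: (measurable_fun_bool true); rewrite setTI preimage_mem_true.
Qed.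

Lemma integrable_dominated (b phi : T -> R) : measurable_fun setT b ->
  measurable_fun setT phi -> (forall y, `|b y| <= phi y) ->
  (\int[mu]_y (phi y)%:E < +oo)%E ->
  mu.-integrable setT (EFin \o b) /\
  (`|\int[mu]_y b y|%:E <= \int[mu]_y (phi y)%:E)%E.
Proof.
move=> mb mphi bphi phioo.
have phi0 y : 0 <= phi y by exact: le_trans (bphi y).
have le1 : (\int[mu]_y `|(b y)%:E| <= \int[mu]_y (phi y)%:E)%E.
  apply: ge0_le_integral => //.
  - by apply: measurableT_comp => //; exact/measurable_EFinP.
  - exact/measurable_EFinP.
  - by move=> y _; rewrite lee_fin.
have ib : mu.-integrable setT (EFin \o b).
  by apply/integrableP; split; [exact/measurable_EFinP|exact: (le_lt_trans le1)].
split => //; rewrite EFin_normr_Rintegral//; apply: le_trans le1.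
by apply: le_abse_integral => //; exact/measurable_EFinP.
Qed.

(** With [delta] the distance to the singularity, b vanishes near it; once e < e0 the truncation no
    longer affects b, and its contribution is the constant full integral. *)
Lemma truncated_cvg (delta a b : T -> R) (e0 : R) : measurable_fun setT delta ->
  0 < e0 -> (forall y, delta y < e0 -> b y = 0) -> mu.-integrable setT (EFin \o b) ->
  (forall e, 0 < e -> mu.-integrable [set y | e < delta y] (fun y => (a y)%:E)) ->
  cvg ((\int[mu]_(y in [set y | e < delta y]) a y) @[e --> 0^'+]) ->
  (forall e, 0 < e -> mu.-integrable [set y | e < delta y] (fun y => (a y + b y)%:E)) /\
  (\int[mu]_(y in [set y | e < delta y]) (a y + b y)) @[e --> 0^'+] -->
    lim ((\int[mu]_(y in [set y | e < delta y]) a y) @[e --> 0^'+]) + \int[mu]_y b y.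
Proof.
move=> mdelta e00 b0 ib ia cva.
have mA e : measurable [set y | e < delta y].
  rewrite (_ : [set y | _] = delta @^-1` `]e, +oo[).
    by rewrite -[X in measurable X]setTI; exact: mdelta.
  by apply/seteqP; split => y /=; rewrite in_itv/= andbT.
have ibe e : mu.-integrable [set y | e < delta y] (EFin \o b).
  exact: (integrableS measurableT (mA e) _ ib).
split; first by move=> e e1; have := integrableD (mA e) (ia e e1) (ibe e).
apply: (cvg_trans (G :=
  (\int[mu]_(y in [set y | e < delta y]) a y + \int[mu]_y b y) @[e --> 0^'+])).
  apply: near_eq_cvg; near=> e.
  have e1 : 0 < e by near: e; exact: nbhs_right_gt.
  have e2 : e < e0 by near: e; exact: nbhs_right_lt.
  rewrite RintegralD//; last exact: ia.
  congr (_ + _); rewrite [RHS]Rintegral_mkcond; apply: eq_Rintegral => y _.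
  rewrite patchE; case: ifPn => //; rewrite notin_setE /= => /negP; rewrite -leNgt => H.
  by rewrite b0// (le_lt_trans H).
by apply: cvgD => //; exact: cvg_cst.
Unshelve. all: by end_near.
Qed.

(** Only the cut-offs of [a] are known to be measurable. At each point other than o they are
    eventually equal to [a], which is thus a pointwise limit; the value at o is patched in
    separately. *)
Lemma measurable_of_cutoffs (A S : set T) (o : T) (F : nat -> set T) (a : T -> R) :
  measurable A -> measurable S -> measurable [set o] -> S `<=` A ->
  (forall y, y <> o -> exists N0, forall N, (N0 <= N)%N -> F N y) ->
  (forall N, measurable_fun A (fun y => a y * \1_(F N) y)) ->
  measurable_fun setT (fun y => a y * \1_S y).
Proof.
move=> mA mS mo SA HF ma.
pose D := (A `&` S) `\ o.
have mD : measurable D by apply: measurableD => //; exact: measurableI.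
have H1 : measurable_fun D a.
  apply/measurable_EFinP; apply: (emeasurable_fun_cvg (fun N y => (a y * \1_(F N) y)%:E)).
    move=> N; apply/measurable_EFinP; apply: measurable_funS (ma N) => //.
    by move=> y [[]].
  move=> y [_ /= yo]; have [N0 H] := HF y yo.
  apply: cvg_near_cst; near=> N; rewrite indicE mem_set ?mulr1//; apply: H.
  by near: N; exact: nbhs_infty_ge.
have H2 : measurable_fun setT (fun y => if y \in D then a y else 0).
  apply: measurable_fun_if => //.
  - exact: measurable_fun_mem.
  - by rewrite setTI preimage_mem_true.
pose c := a o * \1_S o.
rewrite (_ : (fun y => _) = fun y => if y \in [set o] then c else if y \in D then a y else 0).
  apply: measurable_fun_ifT => //.
  exact: measurable_fun_mem.
apply/funext => y; case: ifPn => [|]; first by rewrite inE => ->.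
rewrite notin_setE /= => yo; case: ifPn.
  by rewrite inE => -[[_ Sy] _]; rewrite indicE mem_set// mulr1.
rewrite notin_setE /= => nD; rewrite indicE memNset ?mulr0// => Sy.
by apply: nD; split => //; split => //; exact: SA.
Unshelve. all: by end_near.
Qed.

Lemma cutoff_tail_cvg (o : T) (F : nat -> set T) (phi : T -> R) :
  measurable_fun setT phi -> (forall y, 0 <= phi y) -> (\int[mu]_y (phi y)%:E < +oo)%E ->
  measurable [set o] -> mu [set o] = 0%E -> (forall N, measurable (F N)) ->
  (forall y, y <> o -> exists N0, forall N, (N0 <= N)%N -> F N y) ->
  (\int[mu]_y (phi y * (1 - \1_(F N) y))%:E)%E @[N --> \oo] --> 0%E.
Proof.
move=> mphi phi0 phioo mo mo0 mF HF.
have iphi : mu.-integrable setT (EFin \o phi).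
  apply/integrableP; split; first exact/measurable_EFinP.
  by under eq_integral do rewrite /= ger0_norm//.
have m0 : measurable_fun setT (cst 0%E : T -> \bar R) by exact: measurable_cst.
have mf N : measurable_fun setT (fun y => (phi y * (1 - \1_(F N) y))%:E).
  apply/measurable_EFinP; apply: measurable_funM => //; apply: measurable_funB => //.
have cv : {ae mu, forall y, setT y -> (fun N => (phi y * (1 - \1_(F N) y))%:E) @ \oo --> cst 0%E y}.
  exists [set o]; split => // y /= H; apply: contrapT => yo; apply: H => _.
  have [N0 HN] := HF y yo; apply: cvg_near_cst; near=> N.
  rewrite indicE mem_set ?subrr ?mulr0//; apply: HN.
  by near: N; exact: nbhs_infty_ge.
have dom : {ae mu, forall y (N : nat), setT y ->
    (`|(phi y * (1 - \1_(F N) y))%:E| <= (EFin \o phi) y)%E}.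
  apply: aeW => y N _; rewrite /= lee_fin indicE normrM ger0_norm// ler_piMr//.
  by case: (y \in F N); rewrite /= ?subrr ?normr0// subr0 normr1.
have [_ _] := dominated_convergence measurableT mf m0 cv iphi dom.
by rewrite integral0.
Unshelve. all: by end_near.
Qed.

End Truncations.

Lemma measurable_max_power d (T : measurableType d) (R : realType) (f : T -> R) (a b c : R) n :
  measurable_fun setT f -> measurable_fun setT (fun y => a * (b / Num.max c (f y)) ^+ n).
Proof.
move=> mf; apply: measurable_funM => //; apply: measurable_funX.
apply: measurable_funM => //; apply: measurable_invr_fun.
exact: measurable_maxr.
Qed.

Lemma measurable_mul_norm d (T : measurableType d) (R : realType) (f g : T -> R) :
  measurable_fun setT f -> measurable_fun setT g -> measurable_fun setT (fun y => f y * `|g y|).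
Proof. by move=> mf mg; apply: measurable_funM => //; exact: measurableT_comp. Qed.

Lemma measurable_restr d (T : measurableType d) (R : realType) (f : T -> R) (A : set T) :
  measurable A -> measurable_fun setT f -> measurable_fun setT (fun y => f y * \1_A y).
Proof. by move=> mA mf; apply: measurable_funM => //; exact: measurable_indic. Qed.

Section FarKernel.
Context {R : realType} {n : nat}.
Local Notation T := (Rn R n).
Implicit Types (kk : T -> T -> R) (f g h : T -> R).

(** Majorant of the kernels for x in the shell of index k and y outside the enlarged shell. It
    depends on x through k only; the absolute value is there because no sign of C0 is assumed. *)
Definition far_kernel (C0 : R) (k : int) (y : T) : R :=
  `|C0| * (2 / Num.max (2 ^ k) (eucl_norm y)) ^+ n.

Definition far_bound C0 k h : \bar R := (\int[leb R n]_y (far_kernel C0 k y * `|h y|)%:E)%E.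

Definition restr f (A : set T) : T -> R := fun y => f y * \1_A y.

Lemma measurable_far_kernel C0 k : measurable_fun setT (far_kernel C0 k).
Proof. exact: measurable_max_power (@measurable_eucl_norm R n). Qed.

Lemma far_kernel_ge0 C0 k y : 0 <= far_kernel C0 k y.
Proof.
rewrite mulr_ge0// exprn_ge0// divr_ge0// le_max; apply/orP; left.
exact/ltW/exprz_gt0.
Qed.

(** Either |y| < 2^(k-1) <= |x|/2 or |y| >= 2^(k+2) > 2|x|; in both cases the distance is at least
    half the larger norm. *)
Lemma far_dist k (x y : T) : shell k (k + 1) x -> ~ shell (k - 1) (k + 2) y ->
  Num.max (2 ^ k) (eucl_norm y) <= 2 * eucl_dist x y.
Proof.
move=> /andP[kx xk] /negP; rewrite negb_and -!real_ltNge ?num_real// => yD.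
have e1 : 2 ^ k = 2 * 2 ^ (k - 1) :> R by rewrite -[in LHS](subrK 1 k) expfzDr// expr1z mulrC.
have e2 : 2 ^ (k + 1) = 2 * 2 ^ k :> R by rewrite expfzDr// expr1z mulrC.
have e3 : 2 ^ (k + 2) = 2 * 2 ^ (k + 1) :> R.
  by rewrite (_ : k + 2 = k + 1 + 1) ?expfzDr -?addrA// expr1z mulrC.
have k0 : 0 < (2 : R) ^ (k - 1) by rewrite exprz_gt0.
case/orP: yD => [yk|ky].
  have H := @eucl_dist_ge_half R n x y; rewrite ge_max; apply/andP; split; last by lra.
  by apply: (le_trans kx); apply: H; lra.
have H := @eucl_dist_ge_half R n y x; rewrite ge_max eucl_distC.
have Hd : eucl_norm y <= 2 * eucl_dist y x by apply: H; lra.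
by rewrite Hd andbT; lra.
Qed.

Section OneKernel.
Variables (kk : T -> T -> R) (C0 : R).
Hypothesis kk_le : forall x y, x <> y -> `|kk x y| <= C0 / eucl_dist x y ^+ n.

Lemma kernel_far_le k x y : shell k (k + 1) x -> ~ shell (k - 1) (k + 2) y ->
  `|kk x y| <= far_kernel C0 k y.
Proof.
move=> xk yD; have D := far_dist xk yD.
have m0 : 0 < Num.max (2 ^ k) (eucl_norm y) by rewrite lt_max exprz_gt0.
have d0 : 0 < eucl_dist x y by have := lt_le_trans m0 D; rewrite pmulr_rgt0.
have xy : x <> y.
  move=> xy; apply: yD; rewrite -xy; apply: shell_subset xk; first by rewrite gerBl.
  by rewrite lerD2l.
apply: (le_trans (kk_le xy)); apply: (le_trans (y := `|C0| / eucl_dist x y ^+ n)).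
  by rewrite ler_pM2r ?ler_norm// invr_gt0 exprn_gt0.
rewrite /far_kernel ler_wpM2l// -exprVn; apply: lerXn2r.
- by rewrite nnegrE invr_ge0 ltW.
- by rewrite nnegrE divr_ge0// ltW.
by rewrite ler_pdivlMr// mulrC ler_pdivrMr// mulrC.
Qed.

(** As h vanishes near x, its part of the principal value is an absolutely convergent integral
    dominated by the far kernel. Existence for g therefore implies existence for f. *)
Lemma pv_split k x f g h : shell k (k + 1) x -> (forall y, f y = g y + h y) ->
  (forall y, shell (k - 1) (k + 2) y -> h y = 0) ->
  measurable_fun setT (fun y => kk x y * h y) -> measurable_fun setT h ->
  (far_bound C0 k h < +oo)%E -> pv_defined kk g x ->
  pv_defined kk f x /\ (`|pv kk f x - pv kk g x|%:E <= far_bound C0 k h)%E.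
Proof.
move=> xk fgh h0 mkh mh hoo [ig cvg_g].
have bphi y : `|kk x y * h y| <= far_kernel C0 k y * `|h y|.
  rewrite normrM; have [yD|yD] := pselect (shell (k - 1) (k + 2) y).
    by rewrite h0// normr0 !mulr0.
  by rewrite ler_wpM2r//; exact: kernel_far_le.
have mphi := measurable_mul_norm (measurable_far_kernel C0 k) mh.
have [ikh le_kh] := integrable_dominated mkh mphi bphi hoo.
have kh0 y : eucl_dist x y < 2 ^ (k - 1) -> kk x y * h y = 0.
  move=> dxy; rewrite h0 ?mulr0//; apply: contrapT => yD.
  have := far_dist xk yD; rewrite ge_max => /andP[H _].
  have e1 : 2 ^ k = 2 * 2 ^ (k - 1) :> R by rewrite -[in LHS](subrK 1 k) expfzDr// expr1z mulrC.
  by move: H; rewrite e1 ler_pM2l// leNgt dxy.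
have k0 : 0 < (2 : R) ^ (k - 1) by rewrite exprz_gt0.
have [i_f cvg_f] := truncated_cvg (measurable_eucl_dist x) k0 kh0 ikh ig cvg_g.
have kf y : kk x y * f y = kk x y * g y + kk x y * h y by rewrite fgh mulrDr.
have tf : truncated_integral kk f x =
    fun e => \int[leb R n]_(y in [set y | e < eucl_dist x y]) (kk x y * g y + kk x y * h y).
  by apply/funext => e; apply: eq_Rintegral => y _; exact: kf.
have i_f' e : 0 < e -> (leb R n).-integrable [set y | e < eucl_dist x y]
    (fun y => (kk x y * f y)%:E).
  move=> e0; have -> : (fun y => (kk x y * f y)%:E) =
      (fun y => (kk x y * g y + kk x y * h y)%:E) by apply/funext => y; rewrite kf.
  exact: i_f.
split.
  split; first exact: i_f'.
  by rewrite tf; exact: (cvgP _ cvg_f).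
have -> : pv kk f x = pv kk g x + \int[leb R n]_y (kk x y * h y).
  by rewrite /pv tf; exact: (cvg_lim _ cvg_f).
by rewrite addrAC subrr add0r.
Qed.

Lemma exists_shell_nat (y : T) : y <> rn_origin ->
  exists N0 : nat, forall N, (N0 <= N)%N -> shell (- N%:Z) N%:Z y.
Proof.
move=> y0; have : (~` [set @rn_origin R n]) y by [].
rewrite shell_cover => -[k _ yk]; exists (`|k|.+1)%N => N kN.
have [H1 H2] : - N%:Z <= k /\ k + 1 <= N%:Z by move: kN; clear; lia.
exact: shell_subset yk.
Qed.

Lemma restr_subr f (A : set T) y : f y - restr f A y = f y * \1_(~` A) y.
Proof.
rewrite /restr !indicE in_setC; case: (y \in A); rewrite /= ?mulr1 ?mulr0 ?subrr//.
by rewrite subr0.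
Qed.

(** For this fixed x, measurability in y is extracted from the integrability clause in [pv_defined]
    for the cut-offs of f, followed by a limit in N. *)
Lemma measurable_kernel_tail f k x i j : shell k (k + 1) x -> i <= k - 1 -> k + 2 <= j ->
  (forall N : nat, pv_defined kk (restr f (shell (- N%:Z) N%:Z)) x) ->
  measurable_fun setT (fun y => kk x y * (f y - restr f (shell i j) y)).
Proof.
move=> xk ik kj pvN.
(* Truncation level: off the shell the distance to x is at least 2^(k-1), so the strict inequality
   defining the truncated domain holds there. *)
have k2 : 0 < (2 : R) ^ (k - 2) by rewrite exprz_gt0.
have mA : measurable [set y | 2 ^ (k - 2) < eucl_dist x y].
  have := measurable_eucl_dist x measurableT (measurable_itv `](2 : R) ^ (k - 2), +oo[).
  rewrite setTI; congr (measurable _); apply/seteqP; split => y /=; rewrite in_itv/= andbT//.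
have SA : ~` shell i j `<=` [set y | 2 ^ (k - 2) < eucl_dist x y].
  move=> y yS /=; have yD : ~ shell (k - 1) (k + 2) y.
    by move=> yD; apply: yS; exact: shell_subset yD.
  have := far_dist xk yD; rewrite ge_max => /andP[H _].
  have e1 : 2 ^ k = 2 * (2 * 2 ^ (k - 2)) :> R.
    rewrite -[in LHS](subrK 2 k) expfzDr// (_ : 2 ^ 2%:Z = 2 * 2 :> R)//.
    by rewrite mulrC mulrA.
  lra.
have ma (N : nat) : measurable_fun [set y | 2 ^ (k - 2) < eucl_dist x y]
    (fun y => kk x y * f y * \1_(shell (- N%:Z) N%:Z) y).
  have [H _] := pvN N; have /integrableP[mH _] := H _ k2.
  move/measurable_EFinP: mH; congr (measurable_fun _ _).
  by apply/funext => y; rewrite /restr mulrA.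
have := measurable_of_cutoffs mA (measurableC (@measurable_shell R n i j)) (@measurable_origin R n)
  SA exists_shell_nat ma.
by under eq_fun do rewrite -mulrA -restr_subr.
Qed.

End OneKernel.

End FarKernel.

(** * Measurability of the maximal operator *)

Section AbstractTools.
Context d (T : measurableType d) (R : realType) (mu : {measure set T -> \bar R}).
Local Open Scope ereal_scope.

Lemma ge0_le_integral_EFin (B : set T) (a b : T -> R) : measurable B ->
  measurable_fun setT a -> measurable_fun setT b ->
  (forall y, B y -> (0 <= a y <= b y)%R) ->
  \int[mu]_(y in B) (a y)%:E <= \int[mu]_(y in B) (b y)%:E.
Proof.
move=> mB ma mb ab; apply: ge0_le_integral => //.
- by move=> y /ab /andP[]; rewrite lee_fin.
- by apply/measurable_EFinP; exact: measurable_funTS.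
- by apply/measurable_EFinP; exact: measurable_funTS.
- by move=> y /ab /andP[]; rewrite lee_fin.
Qed.

Lemma ae_forall_countable (I : countType) (P : I -> T -> Prop) :
  (forall i, {ae mu, forall x, P i x}) -> {ae mu, forall x i, P i x}.
Proof.
move=> H; have : {ae mu, forall x (k : nat), if pickle_inv k is Some i then P i x else True}.
  by apply: ae_foralln => k; case: pickle_inv => [i|]; [exact: H|exact: aeW].
by apply: filterS => x Hx i; have := Hx (pickle i); rewrite pickleK_inv.
Qed.

(** The upper limit of the sequence is measurable and agrees with g almost everywhere; completeness
    transfers measurability to g. *)
Lemma measurable_ae_cvg (F : (T -> \bar R)^nat) (g : T -> \bar R) : measure_is_complete mu ->
  (forall N, measurable_fun setT (F N)) ->
  {ae mu, forall x, F ^~ x @ \oo --> g x} -> measurable_fun setT g.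
Proof.
move=> cmu mF Fg; apply: (ae_measurable_fun cmu (f := fun x => limn_esup (F ^~ x))).
  apply: filterS Fg => x Fx _; rewrite is_cvg_limn_esupE; last exact: cvgP Fx.
  exact/cvg_lim.
exact: measurable_fun_limn_esup.
Qed.

End AbstractTools.

(** The limit may be +oo, as values of [Tstar] may be; hence two one-sided bounds with finite errors
    instead of a bound on a difference. *)
Lemma cvg_of_squeeze (R : realType) (a : \bar R) (F t : (\bar R)^nat) :
  (forall N, t N \is a fin_num) -> t @ \oo --> 0%E ->
  (\forall N \near \oo, (a <= F N + t N)%E /\ (F N <= a + t N)%E) -> F @ \oo --> a.
Proof.
move=> tfin t0 H; apply: (@squeeze_cvge _ _ _ _ (fun N => (a - t N)%E) _ (fun N => (a + t N)%E)).
- apply: filterS H => N [H1 H2]; rewrite H2 andbT leeBlDr//.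
- rewrite -[X in _ --> X]sube0; apply: cvgeB => //; [|exact: cvg_cst].
  by rewrite oppe0 fin_num_adde_defl.
- rewrite -[X in _ --> X]adde0; apply: cvgeD => //; [|exact: cvg_cst].
  by rewrite fin_num_adde_defl.
Qed.

Section Maximal.
Context {R : realType} {n : nat} (hn : (0 < n)%N) (J : Type).
Local Notation T := (Rn R n).
Implicit Types (f g h : T -> R) (A : set T) (x y : T) (k : int).
Variables (K : J -> T -> T -> R) (C0 : R).
Hypothesis hC0 : forall j x y, x <> y -> `|K j x y| <= C0 / eucl_dist x y ^+ n.

Lemma Tstar_ge0 f x : (0 <= Tstar K f x)%E.
Proof. by apply: ereal_sup_ubound; left. Qed.

Lemma Tstar_ub f x j : ((`|pv (K j) f x|)%:E <= Tstar K f x)%E.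
Proof. by apply: ereal_sup_ubound; right; exists j. Qed.

Lemma Tstar_le_add f g x (e : \bar R) : (0 <= e)%E ->
  (forall j, (`|pv (K j) f x|%:E <= `|pv (K j) g x|%:E + e)%E) ->
  (Tstar K f x <= Tstar K g x + e)%E.
Proof.
move=> e0 H; apply: ge_ereal_sup => _ [->|[j _ <-]].
  by rewrite adde_ge0// Tstar_ge0.
by apply: (le_trans (H j)); rewrite leeD2r// Tstar_ub.
Qed.

Lemma far_bound_ge0 k h : (0 <= far_bound C0 k h)%E.
Proof.
apply: integral_ge0 => y _; rewrite lee_fin.
by apply: mulr_ge0; [exact: far_kernel_ge0|exact: normr_ge0].
Qed.

Lemma measurable_far_integrand k h : measurable_fun setT h ->
  measurable_fun setT (fun y => far_kernel C0 k y * `|h y|).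
Proof. exact: (measurable_mul_norm (measurable_far_kernel C0 k)). Qed.

Definition tail f A : T -> R := fun y => f y - restr f A y.

Lemma norm_tail f A y : `|tail f A y| = `|f y| * (1 - \1_A y).
Proof.
rewrite /tail /restr indicE; case: (y \in A); rewrite /= ?mulr1 ?mulr0 ?subrr ?normr0 ?mulr0//.
by rewrite !subr0 mulr1.
Qed.

Lemma far_bound_tailE k f A : far_bound C0 k (tail f A) =
  (\int[leb R n]_y (far_kernel C0 k y * `|f y| * (1 - \1_A y))%:E)%E.
Proof. by apply: eq_integral => y _; rewrite norm_tail mulrA. Qed.

Lemma measurable_tail f (A : set T) : measurable A -> measurable_fun setT f ->
  measurable_fun setT (tail f A).
Proof.
by move=> mA mf; exact: (measurable_funB mf (measurable_restr mA mf)).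
Qed.

Lemma far_bound_tail_le k f A : measurable A -> measurable_fun setT f ->
  (far_bound C0 k (tail f A) <= far_bound C0 k f)%E.
Proof.
move=> mA mf; apply: (ge0_le_integral_EFin _ measurableT).
- exact: measurable_far_integrand (measurable_tail mA mf).
- exact: measurable_far_integrand.
move=> y _; rewrite mulr_ge0 ?far_kernel_ge0//= ler_wpM2l ?far_kernel_ge0//.
rewrite norm_tail ler_piMr// indicE; case: (y \in A); rewrite /= ?subrr ?subr0//.
Qed.

(** Serves two purposes. With the enlarged shell it separates the local part from the far part; with
    the shells from 2^(-N) to 2^N it shows convergence of the cut-offs, for which the reverse
    inequality is needed as well. *)
Lemma Tstar_cutoff f k x i j : measurable_fun setT f -> (far_bound C0 k f < +oo)%E ->
  shell k (k + 1) x -> i <= k - 1 -> k + 2 <= j ->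
  (forall i j jj, pv_defined (K jj) (restr f (shell i j)) x) ->
  [/\ forall jj, pv_defined (K jj) f x,
     (Tstar K f x <= Tstar K (restr f (shell i j)) x
        + far_bound C0 k (tail f (shell i j)))%E &
     (Tstar K (restr f (shell i j)) x <= Tstar K f x
        + far_bound C0 k (tail f (shell i j)))%E].
Proof.
move=> mf foo xk ik kj pvf; set h := tail f (shell i j).
have mS : measurable (@shell R n i j) by exact: measurable_shell.
have mh : measurable_fun setT h by exact: measurable_tail.
have hoo : (far_bound C0 k h < +oo)%E by exact: le_lt_trans (far_bound_tail_le k mS mf) foo.
have fgh y : f y = restr f (shell i j) y + h y by rewrite /h /tail addrC subrK.
have h0 y : shell (k - 1) (k + 2) y -> h y = 0.
  move=> yD; rewrite /h /tail /restr indicE mem_set ?mulr1 ?subrr//.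
  exact: shell_subset yD.
have pvs jj := pv_split (@hC0 jj) xk fgh h0
  (measurable_kernel_tail xk ik kj (fun N => pvf _ _ jj)) mh hoo (pvf i j jj).
split; first by move=> jj; exact: (pvs jj).1.
- apply: Tstar_le_add; first exact: far_bound_ge0.
  move=> jj; have [_ H] := pvs jj.
  apply: le_trans (leeD2l _ H); rewrite -EFinD lee_fin.
  by rewrite -{1}(subrK (pv (K jj) (restr f (shell i j)) x) (pv (K jj) f x)) addrC ler_normD.
- apply: Tstar_le_add; first exact: far_bound_ge0.
  move=> jj; have [_ H] := pvs jj.
  apply: le_trans (leeD2l _ H); rewrite -EFinD lee_fin distrC.
  by rewrite -{1}(subrK (pv (K jj) f x) (pv (K jj) (restr f (shell i j)) x)) addrC ler_normD.
Qed.

Lemma ae_shell (P : T -> Prop) :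
  (forall k : int, {ae leb R n, forall x, shell k (k + 1) x -> P x}) ->
  {ae leb R n, forall x, P x}.
Proof.
move=> H; have H1 : {ae leb R n, forall x, x <> rn_origin}.
  exists [set rn_origin]; split; [exact: measurable_origin|exact: leb_origin|].
  by move=> x /= /contrapT.
apply: filterS2 (ae_forall_countable H) H1 => x Hx x0.
have : (~` [set @rn_origin R n]) x by [].
by rewrite shell_cover => -[k _ /Hx].
Qed.

(** Almost everywhere, [Tstar K f] is the limit of its values on cut-offs to growing shells: on each
    shell of index k the error is a far bound of the tail, which tends to 0 by dominated
    convergence. *)
Lemma measurable_Tstar f : measurable_fun setT f -> (forall k, (far_bound C0 k f < +oo)%E) ->
  {ae leb R n, forall x i j jj, pv_defined (K jj) (restr f (shell i j)) x} ->
  (forall i j, measurable_fun setT (Tstar K (restr f (shell i j)))) ->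
  measurable_fun setT (Tstar K f).
Proof.
move=> mf foo pvf mT.
apply: (measurable_ae_cvg (@leb_complete R n) (fun N : nat => mT (- N%:Z) N%:Z)).
apply: ae_shell => k; apply: filterS pvf => x pvx xk.
pose t (N : nat) := far_bound C0 k (tail f (shell (- N%:Z) N%:Z)).
have mS (N : nat) : measurable (@shell R n (- N%:Z) N%:Z) by exact: measurable_shell.
apply: (@cvg_of_squeeze _ _ _ t).
- move=> N; rewrite ge0_fin_numE; last exact: far_bound_ge0.
  exact: le_lt_trans (far_bound_tail_le k (mS N) mf) (foo k).
- rewrite (_ : t = fun N => (\int[leb R n]_y (far_kernel C0 k y * `|f y| *
     (1 - \1_(shell (- N%:Z) N%:Z) y))%:E)%E); last first.
    by apply/funext => N; exact: far_bound_tailE.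
  apply: (cutoff_tail_cvg (measurable_far_integrand k mf) _ (foo k) (@measurable_origin R n)
    (leb_origin hn) mS (@exists_shell_nat R n)).
  by move=> y; apply: mulr_ge0; [exact: far_kernel_ge0|exact: normr_ge0].
near=> N.
have [Nk kN] : - N%:Z <= k - 1 /\ k + 2 <= N%:Z.
  have : (`|k|.+2 <= N)%N by near: N; exact: nbhs_infty_ge.
  by clear; lia.
have [_ H1 H2] := Tstar_cutoff mf (foo k) xk Nk kN pvx.
exact: (conj H1 H2).
Unshelve. all: by end_near.
Qed.

End Maximal.

(** * Weighted estimates *)

Section WeightedTools.
Context d (T : measurableType d) (R : realType) (mu : {measure set T -> \bar R}).
Local Open Scope ereal_scope.
Variables (r : T -> R) (B : set T).
Hypothesis mr : measurable_fun setT r.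
Hypothesis r1 : forall x, (1 <= r x)%R.
Hypothesis mB : measurable B.

Lemma lux_mul_le (g w : T -> \bar R) (c s : R) : measurable_fun setT g -> measurable_fun setT w ->
  (0 < c)%R -> (forall x, B x -> 0 <= w x <= c%:E) ->
  lux mu r B g s -> lux mu r B (fun x => g x * w x) (c * s).
Proof.
move=> mg mw c0 wc [s0 Hs].
have mcg : measurable_fun setT (fun x => c%:E * g x) by exact: emeasurable_funM.
have H : lux mu r B (fun x => c%:E * g x) (c * s).
  by split; [exact: mulr_gt0|rewrite modularZ].
apply: lux_ae_le H => //; first exact: emeasurable_funM.
apply: aeW => x /wc /andP[w0 wxc]; rewrite !abseM muleC.
by rewrite lee_wpmul2r// gee0_abs// gee0_abs// lee_fin ltW.
Qed.

Lemma lux_of_mul_ge (f : T -> R) (w : T -> \bar R) (c s : R) :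
  measurable_fun setT f -> measurable_fun setT w ->
  (0 < c)%R -> (forall x, B x -> c%:E <= w x) ->
  lux mu r B (fun x => (f x)%:E * w x) s -> lux mu r B (EFin \o f) (c^-1 * s).
Proof.
move=> mf mw c0 wc [s0 Hs]; have c1 : (0 < c^-1)%R by rewrite invr_gt0.
have mfw := measurable_mulEFin mf mw.
have H : lux mu r B (fun x => (c^-1)%:E * ((f x)%:E * w x)) (c^-1 * s).
  by split; [exact: mulr_gt0|rewrite modularZ].
apply: lux_ae_le H => //; [exact/measurable_EFinP|exact: emeasurable_funM|].
apply: aeW => x /wc wx; rewrite !abseM muleCA -[leLHS]mule1.
rewrite lee_wpmul2l//= (gtr0_norm c1) gee0_abs; last by rewrite (le_trans _ wx)// lee_fin ltW.
apply: (le_trans (y := (c^-1)%:E * c%:E)); first by rewrite -EFinM mulVf ?gt_eqF.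
by rewrite lee_wpmul2l// lee_fin ltW.
Qed.

Lemma lux_setU (A : set T) (g : T -> \bar R) (s : R) : measurable A -> [disjoint A & B] ->
  measurable_fun setT g -> lux mu r A g s -> lux mu r B g s -> lux mu r (A `|` B) g (2 * s).
Proof.
move=> mA AB mg [s0 HA] [_ HB]; apply: lux_modular_bound => //.
- exact: measurableU.
- by rewrite ler1n.
- by rewrite modular_setU// (_ : 2%:E = 1 + 1)// leeD.
Qed.

(** Writes f as f w times the inverse of w, legitimate where 0 < w < +oo, in preparation for
    Hoelder's inequality. *)
Lemma weighted_integral_le (f ker : T -> R) (w : T -> \bar R) (c : R) :
  measurable_fun setT f -> measurable_fun setT ker -> measurable_fun setT w -> (0 <= c)%R ->
  (forall x, B x -> 0 < w x < +oo) -> (forall x, B x -> 0 <= ker x <= c)%R ->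
  \int[mu]_(x in B) (ker x * `|f x|)%:E <=
  c%:E * \int[mu]_(x in B) (`|(f x)%:E * w x| * `|(w x)^-1|).
Proof.
move=> mf mker mw c0 w0 kerc.
have mfw := measurable_mulEFin mf mw.
have mi := measurable_inve_fun mw.
have m1 : measurable_fun B (fun x => `|(f x)%:E * w x| * `|(w x)^-1|).
  apply: measurable_funTS; apply: emeasurable_funM.
  - exact: measurableT_comp.
  - exact: measurableT_comp.
rewrite -ge0_integralZl_EFin//.
apply: ge0_le_integral => //.
- by move=> x /kerc /andP[H _]; rewrite lee_fin mulr_ge0.
- apply: measurable_funTS; apply/measurable_EFinP; exact: measurable_mul_norm.
- exact: emeasurable_funM.
move=> x Bx; have := w0 x Bx; case: (w x) => [a| |]; rewrite ?ltxx ?andbF//.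
rewrite lte_fin => /andP[a0 _].
rewrite inver gt_eqF//= -!EFinM lee_fin normrM -mulrA -normrM mulfV ?gt_eqF// normr1 mulr1.
by rewrite ler_wpM2r//; case/andP: (kerc x Bx).
Qed.

End WeightedTools.

Section Estimates.
Context {R : realType} {n : nat} (hn : (0 < n)%N).
Local Notation T := (Rn R n).

Lemma shell_disjoint (i j l : int) : [disjoint @shell R n i j & shell j l].
Proof.
apply/disj_setPS => x [/andP[_ H1] /andP[H2 _]].
by move: H1; rewrite ltNge H2.
Qed.

Lemma shell_setU (i j l : int) : i <= j -> j <= l ->
  @shell R n i l = shell i j `|` shell j l.
Proof.
move=> ij jl; apply/seteqP; split => x.
  move=> /andP[H1 H2]; have [H|H] := ltP (eucl_norm x) (2 ^ j); [left|right]; exact/andP.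
by case => H; apply: shell_subset H.
Qed.

Lemma far_kernel_shell (C0 : R) (k j : int) (y : T) : shell j (j + 1) y ->
  far_kernel C0 k y <= `|C0| * 2 ^+ n / (2 ^ Num.max j k) ^+ n.
Proof.
move=> /andP[jy _]; rewrite /far_kernel -mulrA ler_wpM2l// -expr_div_n.
have m0 (m : int) : 0 < (2 : R) ^ m by rewrite exprz_gt0.
have M0 : 0 < Num.max (2 ^ k) (eucl_norm y) by rewrite lt_max m0.
apply: lerXn2r; rewrite ?nnegrE ?divr_ge0 ?(ltW M0) ?(ltW (m0 _))//.
rewrite ler_pM2l// lef_pV2// ?posrE// le_max.
by case: (leP j k) => _; rewrite ?lexx// jy orbT.
Qed.

(** Here t stands for eta^|k-j|, a for [alpha j], x for [tau k] and m for 2^(n max(j,k)). One factor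
    t converts a into x, the other stays for the sum over j, and m cancels the size of the
    kernel. *)
Lemma mul_bound_arith (c K' a v u t x m : R) : 0 < u -> 0 < m -> 0 < c -> 0 < K' -> 0 < t ->
  0 < a -> u * v <= K' * m * t ^+ 2 -> t * a <= x -> 0 <= v ->
  m^-1 * (2 * (c * a) * v) <= 2 * c * K' * x / u * t.
Proof.
move=> u0 m0 c0 K0 t0 a0 uv tx v0.
apply: (le_trans (y := m^-1 * (2 * (c * a) * (K' * m * t ^+ 2 / u)))).
  rewrite ler_pM2l ?invr_gt0// ler_pM2l ?mulr_gt0//.
  by rewrite ler_pdivlMr// mulrC.
have -> : m^-1 * (2 * (c * a) * (K' * m * t ^+ 2 / u)) = 2 * c * K' / u * t * (t * a).
  by field; rewrite !gt_eqF.
have -> : 2 * c * K' * x / u * t = 2 * c * K' / u * t * x by ring.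
by rewrite ler_pM2l// !mulr_gt0// invr_gt0.
Qed.

(** Hoelder's inequality on each shell followed by summation over j. The bound carries 1 / [u k], to
    be cancelled when it is multiplied by w on the shell of index k, where [u k] is admissible for
    w. *)
Lemma far_bound_le (p : T -> R) (w : T -> \bar R) (f : T -> R) (u v alpha tau : int -> R)
    (C0 K' eta S c : R) (k : int) :
  measurable_fun setT p -> (forall x, 1 < p x) -> measurable_fun setT w ->
  (forall j x, shell j (j + 1) x -> (0 < w x < +oo)%E) -> measurable_fun setT f ->
  (forall j, 0 < u j /\ 0 < v j) -> 0 < K' -> 0 < eta -> 0 < c ->
  (forall j, lux (leb R n) (conj_exp p) (shell j (j + 1)) (fun x => (w x)^-1)%E (v j)) ->
  (forall j k, u k * v j <= K' * (2 ^ Num.max j k) ^+ n * (eta ^+ `|k - j|%N) ^+ 2) ->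
  (forall j, 0 < alpha j) ->
  (forall j, lux (leb R n) p (shell j (j + 1)) (fun x => (f x)%:E * w x)%E (c * alpha j)) ->
  (forall j k, eta ^+ `|k - j|%N * alpha j <= tau k) ->
  (forall k : int, (\esum_(j in [set: int]) (eta ^+ `|k - j|%N)%:E <= S%:E)%E) ->
  (far_bound C0 k f <= (`|C0| * 2 ^+ n * (2 * c * K') * S * tau k / u k)%:E)%E.
Proof.
move=> mp p_gt1 mw w0 mf uv0 K0 eta0 c0 luxv uv alpha0 luxf etatau HS.
have q_gt1 x : 1 < conj_exp p x by exact/conj_exp_gt1/p_gt1.
have mq := measurable_conj_exp mp p_gt1.
have mfw := measurable_mulEFin mf mw.
have mi := measurable_inve_fun mw.
have mI j : measurable (@shell R n j (j + 1)) by exact: measurable_shell.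
rewrite /far_bound (ge0_integral_conull_bigcup mI (@trivIset_shell R n)); last 3 first.
- by rewrite -shell_cover setCK; exact: leb_origin.
- by apply/measurable_EFinP; exact: (measurable_far_integrand C0 k mf).
- by move=> y; rewrite lee_fin mulr_ge0 ?far_kernel_ge0 ?normr_ge0.
pose b := `|C0| * 2 ^+ n * (2 * c * K') * tau k / u k.
have u0 := (uv0 k).1.
have tau0 : 0 < tau k by apply: lt_le_trans (etatau k k); rewrite mulr_gt0 ?exprn_gt0.
have b0 : 0 <= b.
  by rewrite /b divr_ge0 ?(ltW u0)// !mulr_ge0 ?exprn_ge0 ?(ltW c0) ?(ltW K0) ?(ltW tau0).
have term (j : int) : (\int[leb R n]_(y in shell j (j + 1)) (far_kernel C0 k y * `|f y|)%:E <=
    b%:E * (eta ^+ `|k - j|%N)%:E)%E.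
  have m0 : 0 < ((2 : R) ^ Num.max j k) ^+ n by rewrite exprn_gt0// exprz_gt0.
  pose cc := `|C0| * 2 ^+ n / (2 ^ Num.max j k) ^+ n.
  have cc0 : 0 <= cc.
    by apply: divr_ge0; [rewrite mulr_ge0 ?exprn_ge0|exact: ltW].
  have kc (x : T) : shell j (j + 1) x -> 0 <= far_kernel C0 k x <= cc.
    by move=> xj; rewrite far_kernel_ge0 far_kernel_shell.
  apply: (le_trans (weighted_integral_le _ (mI j) mf (measurable_far_kernel C0 k)
    mw cc0 (w0 j) kc)).
  have hold := modular_hoelder (mI j) mp mq p_gt1 q_gt1 (fun x => conj_exp_sum (p_gt1 x))
    mfw mi (luxf j) (luxv j).
  apply: (le_trans (y := (cc%:E * (2 * (c * alpha j) * v j)%:E)%E)).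
    by apply: lee_wpmul2l => //; rewrite lee_fin.
  rewrite -!EFinM lee_fin /cc /b.
  have e0 : 0 < eta ^+ `|k - j|%N by exact: exprn_gt0.
  have := mul_bound_arith u0 m0 c0 K0 e0 (alpha0 j) (uv j k) (etatau j k) (ltW (uv0 j).2).
  have CC0 : 0 <= `|C0| * 2 ^+ n by rewrite mulr_ge0 ?exprn_ge0.
  move=> /(ler_wpM2l CC0).
  by rewrite !mulrA.
apply: (le_trans (le_esum (fun j _ => term j))).
apply: (le_trans (esumZl b0 _)); first by move=> j; rewrite lee_fin exprn_ge0 ?(ltW eta0).
apply: (le_trans (y := (b%:E * S%:E)%E)); first by apply: lee_wpmul2l; rewrite ?lee_fin.
rewrite -EFinM lee_fin le_eqVlt; apply/orP; left; apply/eqP; rewrite /b; ring.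
Qed.

(** Minimum over the finitely many dyadic shells in between. This is what places cut-offs of a
    function of the weighted space in the unweighted one. *)
Lemma weight_lower (w : T -> \bar R) :
  (forall k, exists2 m : R, 0 < m & forall x, shell k (k + 1) x -> (m%:E <= w x)%E) ->
  forall i j, exists2 m : R, 0 < m & forall x, shell i j x -> (m%:E <= w x)%E.
Proof.
move=> H i j; have [ji|ij] := ltP j i.
  exists 1 => // x /andP[H1 H2]; have := le_lt_trans H1 H2.
  by rewrite ltr_eXz2l ?ltr1n// => /lt_trans/(_ ji); rewrite ltxx.
have [d [-> _ _]] := int_le_split ij; elim: d {ij} => [|d [m m0 Hm]].
  by exists 1 => // x /andP[H1 H2]; have := le_lt_trans H1 H2; rewrite addr0 ltxx.
have [m' m'0 Hm'] := H (i + d%:Z); exists (Num.min m m'); first by rewrite lt_min m0.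
have -> : i + d.+1%:Z = i + d%:Z + 1 by rewrite -addrA -PoszD addn1.
move=> x; rewrite (@shell_setU i (i + d%:Z)) ?lerDl// => -[/Hm|/Hm'].
  by apply: le_trans; rewrite lee_fin ge_min lexx.
by apply: le_trans; rewrite lee_fin ge_min lexx orbT.
Qed.

End Estimates.

(** * The local part of the maximal operator *)

Section LocalPart.
Context {R : realType} {n : nat}.
Local Notation T := (Rn R n).
Variables (J : Type) (K : J -> T -> T -> R) (p : T -> R) (w : T -> \bar R).
Hypothesis mp : measurable_fun setT p.
Hypothesis p_ge1 : forall x, 1 <= p x.
Hypothesis mw : measurable_fun setT w.

Lemma EFin_mul_cst1 (f : T -> R) : (fun x => (f x)%:E * cst 1 x)%E = EFin \o f.
Proof. by apply/funext => x; rewrite /cst mule1. Qed.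

Lemma mul_cst1 (g : T -> \bar R) : (fun x => g x * cst 1 x)%E = g.
Proof. by apply/funext => x; rewrite /cst mule1. Qed.

Lemma restr_cutoff (f : T -> R) (A : set T) : EFin \o restr f A = cutoff (EFin \o f) A.
Proof. by []. Qed.

Lemma restr_lux (f : T -> R) (A : set T) (m s : R) : measurable A -> measurable_fun setT f ->
  0 < m -> (forall x, A x -> (m%:E <= w x)%E) ->
  lux (leb R n) p A (fun x => (f x)%:E * w x)%E s ->
  lux (leb R n) p setT (EFin \o restr f A) (m^-1 * s).
Proof.
move=> mA mf m0 wm Hs; rewrite restr_cutoff.
apply: (lux_cutoff _ _ measurableT mA p_ge1).2; rewrite setTI.
exact: (lux_of_mul_ge mp p_ge1 mA mf mw m0 wm Hs).
Qed.

Lemma restr_varL (f : T -> R) (A : set T) (m : R) : measurable A -> 0 < m ->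
  (forall x, A x -> (m%:E <= w x)%E) -> varL p w f -> varL p (cst 1%E) (restr f A).
Proof.
move=> mA m0 wm [mf ffin]; split; first exact: measurable_restr.
have mfw := measurable_mulEFin mf mw.
have [s Hs] : exists s : R, (varnorm p (fun x => (f x)%:E * w x) < s%:E)%E.
  move: ffin; set N := varnorm _ _ => Nfin.
  have N0 : (0 <= N)%E by exact: varnorm_ge0.
  exists (fine N + 1); rewrite -{1}(@fineK _ N) ?ge0_fin_numE// lte_fin.
  by rewrite ltrDl.
have lxT := varnorm_lt_lux mp p_ge1 mfw Hs.
have lxA := lux_subset mp p_ge1 mA measurableT (@subsetT _ A) mfw lxT.
rewrite EFin_mul_cst1; apply: le_lt_trans (ltry (m^-1 * s)).
exact: lux_varnorm (restr_lux mA mf m0 wm lxA).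
Qed.

(** Removing the weight costs 1/m and restoring it costs C1 m, so the size of w on the shell
    cancels. In the 8, a factor 4 comes from gluing three dyadic shells and a factor 2 from passing
    to a strict inequality. *)
Lemma local_bound (f : T -> R) (k : int) (m C1 A s : R) : 0 < A -> 0 < C1 -> 0 < m ->
  (forall g, varL p (cst 1%E) g ->
    [/\ {ae leb R n, forall x, forall j, pv_defined (K j) g x},
        measurable_fun setT (Tstar K g)
      & (varnorm p (fun x => Tstar K g x * cst 1 x) <=
        A%:E * varnorm p (fun x => (g x)%:E * cst 1 x))%E]) ->
  measurable_fun setT f ->
  (forall x, shell (k - 1) (k + 2) x -> (m%:E <= w x <= (C1 * m)%:E)%E) ->
  (forall i : int, k - 1 <= i -> i <= k + 1 ->
    lux (leb R n) p (shell i (i + 1)) (fun x => (f x)%:E * w x)%E s) ->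
  lux (leb R n) p (shell k (k + 1))
    (fun x => Tstar K (restr f (shell (k - 1) (k + 2))) x * w x)%E (8 * A * C1 * s).
Proof.
move=> A0 C10 m0 hT mf wm luxf.
set D := shell (k - 1) (k + 2).
have mS i j : measurable (@shell R n i j) by exact: measurable_shell.
have mfw := measurable_mulEFin mf mw.
have s0 : 0 < s.
  by have [] := luxf k; rewrite ?gerBl ?lerDl.
have lD : lux (leb R n) p D (fun x => (f x)%:E * w x)%E (2 * (2 * s)).
  have -> : D = (shell (k - 1) k `|` shell k (k + 1)) `|` shell (k + 1) (k + 2).
    rewrite -(@shell_setU R n (k - 1)) ?gerBl ?lerDl// -shell_setU//.
      by rewrite (le_trans (y := k)) ?gerBl ?lerDl.
    by rewrite lerD2l.
  have l1 : lux (leb R n) p (shell (k - 1) k) (fun x => (f x)%:E * w x)%E s.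
    by have := luxf (k - 1) (lexx _); rewrite subrK; apply; rewrite lerD2l.
  have l2 : lux (leb R n) p (shell k (k + 1)) (fun x => (f x)%:E * w x)%E s.
    by apply: luxf; rewrite ?gerBl ?lerDl.
  have l3 : lux (leb R n) p (shell (k + 1) (k + 2)) (fun x => (f x)%:E * w x)%E s.
    have := luxf (k + 1); rewrite -(addrA k 1 1); apply => //.
    by rewrite lerD2l.
  have l12 := lux_setU mp p_ge1 (mS _ _) (mS _ _) (shell_disjoint _ _ _) mfw l1 l2.
  apply: (lux_setU mp p_ge1 (mS _ _) (measurableU _ _ (mS _ _) (mS _ _)) _ mfw l12).
    rewrite -shell_setU ?gerBl ?lerDl//; exact: shell_disjoint.
  by apply: (lux_le mp p_ge1 (mS _ _) mfw _ l3); rewrite ler_peMl ?ltW// ltr1n.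
have mD : measurable D by exact: mS.
have wD x : D x -> (m%:E <= w x)%E by move=> /wm /andP[].
have lg := restr_lux mD mf m0 wD lD.
set g := restr f D.
have gv : varL p (cst 1%E) g.
  split; first exact: measurable_restr.
  by rewrite EFin_mul_cst1; apply: le_lt_trans (lux_varnorm lg) (ltry _).
have [_ mTg] := hT g gv; rewrite mul_cst1 EFin_mul_cst1 => Tg.
have Tg' : (varnorm p (Tstar K g) < (2 * (A * (m^-1 * (2 * (2 * s)))))%:E)%E.
  apply: (le_lt_trans Tg).
  apply: (le_lt_trans (y := (A%:E * (m^-1 * (2 * (2 * s)))%:E)%E)).
    by apply: lee_wpmul2l; [rewrite lee_fin ltW|exact: lux_varnorm].
  rewrite -EFinM lte_fin ltr_pMl ?ltr1n// !mulr_gt0// invr_gt0//.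
have lT := varnorm_lt_lux mp p_ge1 mTg Tg'.
have lI := lux_subset mp p_ge1 (mS k (k + 1)) measurableT (@subsetT _ _) mTg lT.
have ID : @shell R n k (k + 1) `<=` D.
  by apply: shell_subset; [rewrite gerBl|rewrite lerD2l].
have wI x : shell k (k + 1) x -> (0 <= w x <= (C1 * m)%:E)%E.
  by move=> /ID /wm /andP[H1 H2]; rewrite H2 (le_trans _ H1)// lee_fin ltW.
have := lux_mul_le mp p_ge1 (mS k (k + 1)) mTg mw (mulr_gt0 C10 m0) wI lI.
rewrite (_ : C1 * m * (2 * (A * (m^-1 * (2 * (2 * s))))) = 8 * A * C1 * s)//.
by field; rewrite gt_eqF.
Qed.

End LocalPart.

(** * Assembly of the local and far parts *)

Lemma abse_mul_leD (R : realType) (a b e w : \bar R) : (0 <= a)%E -> (0 <= b)%E ->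
  (0 <= e)%E -> (0 <= w)%E -> (a <= b + e)%E -> (`|a * w| <= `|b * w| + `|e * w|)%E.
Proof.
move=> a0 b0 e0 w0 abe; rewrite !gee0_abs ?mule_ge0//.
by rewrite -ge0_muleDl// lee_wpmul2r.
Qed.

Lemma int_near (k i : int) : k - 1 <= i -> i <= k + 1 -> (`|k - i| <= 1)%N.
Proof. by lia. Qed.

Theorem theorem1p15 (R : realType) (n : nat) (hn : (0 < n)%N) (J : Type)
    (K : J -> Rn R n -> Rn R n -> R) (C0 : R)
    (hK : forall j, kernel_measurable (K j))
    (hC0 : forall j x y, x <> y -> `|K j x y| <= C0 / eucl_dist x y ^+ n)
    (p : Rn R n -> R) (hp : variable_exponent p) (hp0 : LH0 p) (hpoo : LHoo p)
    (hpinf : (1 < exp_inf p)%E) (hpinfsup : (exp_inf p <= exp_sup p)%E)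
    (hpsup : (exp_sup p < +oo)%E)
    (hballs : ball_summable p)
    (hT : strong_type p (cst 1%E) K)
    (w : Rn R n -> \bar R) (hw : is_weight w) (hwA : Ap0 p w)
    (C1 : R) (hC1 : 0 < C1)
    (hwC1 : forall k : int,
      (ereal_sup [set w x | x in dyadic_annulus k] <=
       C1%:E * ereal_inf [set w x | x in dyadic_annulus k])%E) :
  strong_type p w K.
Proof.
have [mp p_ge1 [pmax p_le]] := hp; have [mw _ _ w_ae] := hw.
have p_gt1 x : 1 < p x by have [p1 p11 H] := exp_inf_gt1 hpinf; exact: lt_le_trans (H x).
have [u [v [Kc [eta [[Kc0 eta01] uv0 luxu luxv uvb]]]]] :=
  weight_decay hn mp hpinf p_le mw w_ae hwA hC1 hwC1.
have [eta0 eta1] := andP eta01.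
have wsh := weight_on_shell hn w_ae hC1 hwC1.
have wI k : exists2 m : R, 0 < m & forall x, shell k (k + 1) x -> (m%:E <= w x <= (C1 * m)%:E)%E.
  have [m m0 H] := wsh k; exists m => // x Ix; apply: H.
  by apply: shell_subset Ix; [rewrite gerBl|rewrite lerD2l].
have w_pos k x : shell k (k + 1) x -> (0 < w x < +oo)%E.
  have [m m0 H] := wI k; move=> /H /andP[H1 H2]; rewrite (lt_le_trans _ H1)//=.
  exact: le_lt_trans H2 (ltry _).
have w_low := weight_lower (fun k => let: ex_intro2 m m0 H := wI k in
  ex_intro2 _ _ m m0 (fun x Ix => (andP (H x Ix)).1)).
have [p0 [poo [L [p01 poo1 L0 pP]]]] := exponent_on_shells hp hp0 hpoo.
have mI k : measurable (@shell R n k (k + 1)) by exact: measurable_shell.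
have I_null : leb R n (~` \bigcup_(k : int) shell k (k + 1)) = 0%E.
  by rewrite -shell_cover setCK; exact: leb_origin.
have [Cg Cg0 glue] := shell_glue mp p_ge1 mI (@trivIset_shell R n) I_null p01 poo1 L0 pP eta01.
have [S S1 HS] := esum_geometric_int eta01.
have S0 : 0 < S by exact: lt_le_trans S1.
have [A [A0 hTA]] := hT.
(* Local constant plus far constant, doubled by [lux_add]. The 1 / eta accounts for the two
   neighbouring shells in the local part; |C0| + 1 keeps the far constant positive even if C0 =
   0. *)
pose D0 := 2 * (8 * A * C1 * (Cg / eta) + (`|C0| + 1) * 2 ^+ n * (2 * Cg * Kc) * S).
have B0 : 0 < (`|C0| + 1) * 2 ^+ n * (2 * Cg * Kc) * S.
  by rewrite !mulr_gt0 ?exprn_gt0// ltr_wpDl.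
have B1 : 0 < 8 * A * C1 * (Cg / eta) by apply: mulr_gt0; [rewrite !mulr_gt0|exact: divr_gt0].
have D00 : 0 < D0 by rewrite mulr_gt0// addr_gt0.
exists (Cg * D0); split; first exact: mulr_gt0.
move=> f fL; have [mf ffin] := fL.
have mfw := measurable_mulEFin mf mw.
pose nf := varnorm p (fun x => (f x)%:E * w x)%E.
have nf0 : (0 <= nf)%E by exact: varnorm_ge0.
have nfE : nf = (fine nf)%:E by rewrite fineK// ge0_fin_numE.
have fine0 : 0 <= fine nf by rewrite -lee_fin -nfE.
have rL i j : varL p (cst 1%E) (restr f (shell i j)).
  have [m m0 Hm] := w_low i j.
  exact: (restr_varL mp p_ge1 mw (@measurable_shell R n i j) m0 Hm fL).
have pv_ae : {ae leb R n, forall x i j jj, pv_defined (K jj) (restr f (shell i j)) x}.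
  apply: ae_forall_countable => i; apply: ae_forall_countable => j.
  by have [] := hTA _ (rL i j).
have mTr i j : measurable_fun setT (Tstar K (restr f (shell i j))).
  by have [] := hTA _ (rL i j).
(* Measurability of [Tstar K f] is only a premise of the second half, because it is itself deduced
   from the finiteness of the far bounds in the first half. *)
have key l : lux (leb R n) p setT (fun x => (f x)%:E * w x)%E l ->
    (forall k, (far_bound C0 k f < +oo)%E) /\
    (measurable_fun setT (Tstar K f) ->
     lux (leb R n) p setT (fun x => Tstar K f x * w x)%E (Cg * (D0 * l))).
  move=> Hl; have l0 := Hl.1.
  have [alpha [tau [alpha0 tau0 luxf etatau gluing]]] := glue _ _ mfw Hl.
  have Cgl : 0 < Cg * l by exact: mulr_gt0.
  have luxf' j : lux (leb R n) p (shell j (j + 1)) (fun x => (f x)%:E * w x)%E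
      (Cg * l * alpha j).
    by rewrite -mulrA; exact: luxf.
  have far_le k := far_bound_le hn C0 k mp p_gt1 mw w_pos mf uv0 Kc0 eta0 Cgl luxv uvb alpha0
    luxf' etatau HS.
  have far_fin k : (far_bound C0 k f < +oo)%E by exact: le_lt_trans (far_le k) (ltry _).
  split => // mTf; apply: gluing; first exact: mulr_gt0.
    exact: emeasurable_funM mTf mw.
  move=> k; have [u0 v0] := uv0 k; have t0 := tau0 k.
  (* A constant majorant of the far part on this shell; times w it has admissible number e * [u k],
     which is a multiple of l * [tau k], as the gluing requires. *)
  pose e := (`|C0| + 1) * 2 ^+ n * (2 * (Cg * l) * Kc) * S * tau k / u k.
  have e0 : 0 < e.
    by rewrite /e divr_gt0// !mulr_gt0 ?exprn_gt0// ltr_wpDl.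
  have far_e : (far_bound C0 k f <= e%:E)%E.
    apply: (le_trans (far_le k)); rewrite lee_fin /e.
    have X0 : 0 < 2 ^+ n * (2 * (Cg * l) * Kc) * S * tau k / u k.
      by rewrite divr_gt0// !mulr_gt0 ?exprn_gt0.
    rewrite -subr_ge0 (_ : _ - _ = 2 ^+ n * (2 * (Cg * l) * Kc) * S * tau k / u k); last by ring.
    exact: ltW.
  have [m m0 wm] := wsh k.
  have near_lux (i : int) : k - 1 <= i -> i <= k + 1 ->
      lux (leb R n) p (shell i (i + 1)) (fun x => (f x)%:E * w x)%E (Cg * l * tau k / eta).
    move=> ki ik; apply: (lux_le mp p_ge1 (mI i) mfw _ (luxf' i)).
    rewrite -[leRHS]mulrA ler_pM2l// ler_pdivlMr//.
    apply: le_trans (etatau i k); rewrite mulrC ler_pM2r//.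
    by rewrite -[leLHS]expr1 ler_wiXn2l ?(ltW eta0) ?(ltW eta1)// int_near.
  have loc := local_bound mp p_ge1 mw A0 hC1 m0 hTA mf wm near_lux.
  have luxe : lux (leb R n) p (shell k (k + 1)) (fun x => e%:E * w x)%E (e * u k).
    by have [uk Hu] := luxu k; split; [exact: mulr_gt0|rewrite modularZ].
  have mloc : measurable_fun setT
      (fun x => Tstar K (restr f (shell (k - 1) (k + 2))) x * w x)%E.
    exact: emeasurable_funM (mTr _ _) mw.
  have mew : measurable_fun setT (fun x => e%:E * w x)%E.
    exact: emeasurable_funM (measurable_cst _) mw.
  have mTw : measurable_fun setT (fun x => Tstar K f x * w x)%E.
    exact: emeasurable_funM mTf mw.
  have split_ae : {ae leb R n, forall x, shell k (k + 1) x ->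
      (`|Tstar K f x * w x| <=
       `|Tstar K (restr f (shell (k - 1) (k + 2))) x * w x| + `|e%:E * w x|)%E}.
    apply: filterS pv_ae => x pvx xk.
    have [_ H _] := Tstar_cutoff hC0 mf (far_fin k) xk (lexx (k - 1)) (lexx (k + 2)) pvx.
    have w0 : (0 <= w x)%E by case/andP: (w_pos _ _ xk) => /ltW.
    have e0' : (0 <= e%:E)%E by rewrite lee_fin ltW.
    apply: (abse_mul_leD (Tstar_ge0 _ _ _) (Tstar_ge0 _ _ _) e0' w0).
    apply: (le_trans H); apply: leeD2l.
    exact: le_trans (far_bound_tail_le C0 k (@measurable_shell R n _ _) mf) far_e.
  have := lux_add mp p_ge1 (mI k) mloc mew mTw split_ae loc luxe.
  rewrite (_ : 2 * _ = D0 * l * tau k)//.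
  rewrite /D0 /e; field; rewrite !gt_eqF//.
have far_fin k : (far_bound C0 k f < +oo)%E.
  have Hl : (nf < (fine nf + 1)%:E)%E by rewrite {1}nfE lte_fin ltrDl.
  by have [] := key _ (varnorm_lt_lux mp p_ge1 mfw Hl).
have mTf := measurable_Tstar hn hC0 mf far_fin pv_ae mTr.
split => //.
- apply: (ae_shell hn) => k; apply: filterS pv_ae => x pvx xk.
  by have [] := Tstar_cutoff hC0 mf (far_fin k) xk (lexx (k - 1)) (lexx (k + 2)) pvx.
- rewrite -/nf nfE -EFinM; apply/lee_addgt0Pr => d d0.
  have CD0 : 0 < Cg * D0 by exact: mulr_gt0.
  (* Only numbers strictly above the norm are known to be admissible; the excess is chosen so that
     the final constant turns it into d. *)
  pose l := fine nf + d / (Cg * D0).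
  have Hl : (nf < l%:E)%E by rewrite {1}nfE lte_fin ltrDl divr_gt0.
  have [_ /(_ mTf) /lux_varnorm] := key _ (varnorm_lt_lux mp p_ge1 mfw Hl).
  rewrite mulrA /l mulrDr (mulrC (Cg * D0) (d / _)) divfK ?gt_eqF// EFinD.
Qed.
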